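(* Let $\mu=0$, let $\nu\in\{0,1\}$, let $n\geq 2$ and $m,N\geq 1$ be integers, let $f:[-1,1]\to(-\infty,\infty]$ be an admissible potential function such that $f^{(2m+\nu)}\geq 0$ on $(-1,1)$, and let the weighted code $(C,W)=(x_1,\ldots,x_N;w_1,\ldots,w_N)\in\mathcal J_{n,N}$ be a $(2m-1+\nu)$-design. Let $\lambda_j$ and $\tau_j$, $j=1-\nu,\ldots,m$, be the nodes and weights of the quadrature (Q) of the context with $\mu=0$. Then $$U_f(x,C;W)=\sum_{i=1}^{N}w_if(x\cdot x_i)\geq \sum_{j=1-\nu}^{m}\tau_jf(\lambda_j),\qquad x\in \mathbb{S}^{n-1}.\qquad ( * )$$ If $\nu=0$ and $(C,W)$ is $m$-stiff, or $\nu=1$ and $(C,W)$ is a weakly sharp $2m$-design, then equality holds in $( * )$ at every point $x\in A_{0,\nu}$ forming $m+\nu$ distinct dot products with points of the code $C$. If $f^{(2m+\nu)}>0$ on $(-1,1)$ and equality holds in $( * )$ at some point $x\in \mathbb{S}^{n-1}$, then (i) the point $x$ lies in $A_{0,\nu}$ and forms exactly $m+\nu$ distinct dot products, namely $\lambda_{1-\nu},\ldots,\lambda_m$, with points of the code $C$; (ii) the weighted code $(C,W)$ is $m$-stiff if $\nu=0$ and is a weakly sharp $2m$-design if $\nu=1$; and (iii) for every $j=1-\nu,\ldots,m$, the sum of the weights of the points of $C$ forming dot product $\lambda_j$ with $x$ is exactly $\tau_j$.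
   Context: $\mathbb S^{n-1}$ is the unit sphere in $\mathbb R^n$, $x\cdot y$ is the standard dot product, and $\mathbb P_k$ is the space of univariate real polynomials of degree at most $k$. $\mathcal J_{n,N}$ is the set of weighted codes $(C,W)=(x_1,\ldots,x_N;w_1,\ldots,w_N)$, where $C=\{x_1,\ldots,x_N\}$ consists of $N$ pairwise distinct points of $\mathbb S^{n-1}$ and $W=(w_1,\ldots,w_N)$ has strictly positive components with $w_1+\ldots+w_N=1$; $w_i$ is the weight of $x_i$. An admissible potential function is a function $f:[-1,1]\to(-\infty,\infty]$ that is finite and differentiable on $(-1,1)$ and satisfies $\lim_{t\to-1^+}f(t)=f(-1)$ and $\lim_{t\to1^-}f(t)=f(1)$. A condition on $f^{(k)}$ on $(-1,1)$ includes the existence of that derivative there. The potential is $U_f(x,C;W):=\sum_{i=1}^N w_i f(x\cdot x_i)$. A weighted code $(C,W)\in\mathcal J_{n,N}$ is a (weighted spherical) $k$-design if for every $p\in\mathbb P_k$ the sum $\sum_{i=1}^N w_i p(x\cdot x_i)$ is constant in $x\in\mathbb S^{n-1}$ (the constant is then $\int_{-1}^1p(t)w_n(t)\,dt$), where $w_n(t)=\gamma_n(1-t^2)^{(n-3)/2}$ and $\gamma_n>0$ makes $w_n$ a probability density on $[-1,1]$. $(C,W)$ is $m$-stiff ($m\ge1$) if it is a $(2m-1)$-design and some point $z\in\mathbb S^{n-1}$ forms at most $m$ distinct values of dot product with all points of $C$. $(C,W)$ is a weakly sharp $2m$-design ($m\ge 1$) if it is a $2m$-design and $C$ contains a point $z$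 forming at most $m$ distinct dot products with other points of $C$. Sets: $A_{0,0}:=\mathbb S^{n-1}$ and $A_{0,1}:=-C$. Quadrature (Q): for $\mu,\nu\in\{0,1\}$ let $P_m^{\mu,\nu}$ be the polynomial of degree $m$ orthogonal to $\mathbb P_{m-1}$ on $[-1,1]$ with weight $(1-t)^\mu(1+t)^\nu w_n(t)$, normalized by $P_m^{\mu,\nu}(1)=1$; its zeros are simple and lie in $(-1,1)$. Let $-1\le\lambda_{1-\nu}<\ldots<\lambda_{m+\mu}\le1$ be the zeros of $P_m^{\mu,\nu}(t)(1-t)^\mu(1+t)^\nu$ (so $\lambda_1,\ldots,\lambda_m$ are the zeros of $P_m^{\mu,\nu}$, $\lambda_0=-1$ if $\nu=1$, $\lambda_{m+1}=1$ if $\mu=1$), and let $\tau_{1-\nu},\ldots,\tau_{m+\mu}$ be the unique weights such that $$\int_{-1}^1p(t)w_n(t)\,dt=\sum_{k=1-\nu}^{m+\mu}\tau_kp(\lambda_k)\quad\text{for all }p\in\mathbb P_{2m-1+\mu+\nu}.$$ *)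

(* Defs.v *)
From HB Require Import structures.
From mathcomp Require Export all_boot all_order all_algebra.
From mathcomp Require Export all_classical all_reals all_analysis.

Set Implicit Arguments.
Unset Strict Implicit.
Unset Printing Implicit Defensive.
Import Order.TTheory GRing.Theory Num.Theory.
Import numFieldNormedType.Exports.

Local Open Scope classical_set_scope.
Local Open Scope ring_scope.

(* The normed-space structure on row vectors is the sup norm, so the Euclidean
   sphere is written with the dot product. *)
Definition dotp (R : realType) (n : nat) (x y : 'rV[R]_n) : R :=
  \sum_(i < n) x 0 i * y 0 i.

Definition unit_sphere (R : realType) (n : nat) : set 'rV[R]_n :=
  [set x | dotp x x = 1].
Arguments unit_sphere {R n}.

Definition weighted_code (R : realType) (n N : nat)
    (C : 'I_N -> 'rV[R]_n) (w : 'I_N -> R) : Prop :=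
  [/\ injective C, (forall i, unit_sphere (C i)), (forall i, 0 < w i)
    & \sum_(i < N) w i = 1].

(* [f] is only ever constrained and used on [-1, 1]. *)
Definition admissible (R : realType) (f : R -> \bar R) : Prop :=
  [/\ (forall t : R, -1 <= t <= 1 -> f t != -oo%E),
      (forall t : R, -1 < t < 1 -> f t \is a fin_num),
      (forall t : R, -1 < t < 1 -> derivable (fine \o f) t 1),
      f t @[t --> at_right (-1 : R)] --> f (-1)
    & f t @[t --> at_left (1 : R)] --> f 1].

Definition has_deriv_n (R : realType) (k : nat) (f : R -> \bar R) : Prop :=
  forall (j : nat) (t : R), (j < k)%N -> -1 < t < 1 ->
    derivable (derive1n j (fine \o f)) t 1.

Definition deriv_n_ge0 (R : realType) (k : nat) (f : R -> \bar R) : Prop :=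
  has_deriv_n k f /\ forall t : R, -1 < t < 1 -> 0 <= derive1n k (fine \o f) t.

Definition deriv_n_gt0 (R : realType) (k : nat) (f : R -> \bar R) : Prop :=
  has_deriv_n k f /\ forall t : R, -1 < t < 1 -> 0 < derive1n k (fine \o f) t.

Definition potential (R : realType) (n N : nat) (f : R -> \bar R)
    (C : 'I_N -> 'rV[R]_n) (w : 'I_N -> R) (x : 'rV[R]_n) : \bar R :=
  (\sum_(i < N) (w i)%:E * f (dotp x (C i)))%E.

Definition design (R : realType) (n N : nat) (k : nat)
    (C : 'I_N -> 'rV[R]_n) (w : 'I_N -> R) : Prop :=
  weighted_code C w /\
  forall p : {poly R}, (size p <= k.+1)%N ->
    exists c : R, forall x, unit_sphere x ->
      \sum_(i < N) w i * p.[dotp x (C i)] = c.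

Definition dots (R : realType) (n N : nat) (x : 'rV[R]_n)
    (C : 'I_N -> 'rV[R]_n) : seq R :=
  undup [seq dotp x (C i) | i <- enum 'I_N].

Definition stiff (R : realType) (n N : nat) (m : nat)
    (C : 'I_N -> 'rV[R]_n) (w : 'I_N -> R) : Prop :=
  [/\ (1 <= m)%N, design (2 * m - 1) C w
    & exists2 z, unit_sphere z & (size (dots z C) <= m)%N].

Definition weakly_sharp (R : realType) (n N : nat) (m : nat)
    (C : 'I_N -> 'rV[R]_n) (w : 'I_N -> R) : Prop :=
  [/\ (1 <= m)%N, design (2 * m) C w
    & exists k : 'I_N,
        (size (undup [seq dotp (C k) (C i) | i <- enum 'I_N & i != k])
           <= m)%N].

Definition setA0 (R : realType) (n N : nat) (nu : nat)
    (C : 'I_N -> 'rV[R]_n) : set 'rV[R]_n :=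
  if nu == 0%N then unit_sphere else [set - C i | i in [set: 'I_N]].

Definition wn_unnorm (R : realType) (n : nat) (t : R) : R :=
  (1 - t ^+ 2) `^ ((n%:R - 3) / 2).

Definition wn (R : realType) (n : nat) (t : R) : R :=
  (\int[lebesgue_measure]_(s in `[(-1 : R), 1]) wn_unnorm n s)^-1
    * wn_unnorm n t.

Definition wint (R : realType) (n : nat) (p : {poly R}) : R :=
  \int[lebesgue_measure]_(t in `[(-1 : R), 1]) (p.[t] * wn n t).

Definition endpoint_factor (R : realType) (mu nu : nat) : {poly R} :=
  (1 - 'X) ^+ mu * (1 + 'X) ^+ nu.

Definition is_Pmunu (R : realType) (n m mu nu : nat) (P : {poly R}) : Prop :=
  [/\ size P = m.+1,
      (forall q : {poly R}, (size q <= m)%N ->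
         wint n (P * q * endpoint_factor R mu nu) = 0)
    & P.[1] = 1].

(* Nodes and weights are indexed by [1 - nu <= k <= m + mu]; the values of
   [lam] and [tau] outside this range are irrelevant. *)
Definition quad_nodes (R : realType) (n m mu nu : nat) (lam : nat -> R)
    : Prop :=
  exists2 P : {poly R}, is_Pmunu n m mu nu P &
    (forall j k : nat,
       (1 - nu <= j)%N -> (j < k)%N -> (k <= m + mu)%N -> lam j < lam k) /\
    (forall t : R, root (P * endpoint_factor R mu nu) t <->
       exists2 k : nat, (1 - nu <= k <= m + mu)%N & t = lam k).

Definition quadrature (R : realType) (n m mu nu : nat) (lam tau : nat -> R)
    : Prop :=
  quad_nodes n m mu nu lam /\
  forall p : {poly R}, (size p <= 2 * m + mu + nu)%N ->
    wint n p = \sum_(1 - nu <= k < (m + mu).+1) tau k * p.[lam k].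

(* Main.v *)
Require Import Defs.
From mathcomp Require Import measurable_realfun zify ring lra.
Set Implicit Arguments.
Unset Strict Implicit.
Unset Printing Implicit Defensive.
Import Order.TTheory GRing.Theory Num.Theory.
Import numFieldNormedType.Exports.
Local Open Scope classical_set_scope.
Local Open Scope ring_scope.

(** On polynomials of low degree the two sides of the bound agree.  Since [C]
    is a design, [sum_i w_i p(x . x_i)] is independent of [x] for polynomials
    [p] of degree at most [2m - 1 + nu]; its value is [wint n p], which the
    quadrature writes as [sum_j tau_j p(lam_j)].  Take for [p] the Hermite
    interpolant of [f] at the nodes, of degree at most [2m - 1 + nu], with
    double contact at the nodes [lam_1, ..., lam_m] inside (-1, 1) and, when
    [nu = 1], simple contact at [lam_0 = -1].  The remainder formula
    [f(t) - p(t) = f^(2m+nu)(xi) / (2m+nu)! * (1+t)^nu * prod_j (t - lam_j)^2]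
    shows [p <= f] on [-1, 1] ([hermite_minorant]), so
    [U_f(x) >= sum_i w_i p(x . x_i) = sum_j tau_j p(lam_j)
            = sum_j tau_j f(lam_j)].

    Equality holds as soon as all dot products of [x] with the code are nodes,
    and, when the derivative is positive, only then, because [p < f] off the
    nodes.  In that case the quadrature applied to the polynomial vanishing at
    all nodes but [lam_j] identifies the total weight at [lam_j] with [tau_j]
    ([node_weights]); as [tau_j > 0], every node is attained.  Conversely, if
    [x] has [m + nu] dot products with the code (one of them -1 when
    [nu = 1]), the polynomial [q] vanishing at them is orthogonal to degree
    [m - 1]; with the quadrature this forces [q(lam_j) = 0] for all [j], so the
    dot products are the nodes ([dots_eq_nodes]).

    Three facts carry this.
    - The constant value of a design is [wint n] ([design_wintE]).  The moments
      [c_j = sum_i w_i (x . x_i)^j] obey [(n+j) c_(j+2) = (j+1) c_j], which is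
      the Laplacian of [v -> sum_i w_i (v . x_i)^(j+2) = c_(j+2) |v|^(j+2)];
      the moments of the weight [(1 - t^2)^((n-3)/2)] obey the same recursion
      by integration by parts ([wint_moment]).  No integral over the sphere is
      involved.
    - [wint n] is positive on nonzero polynomials that are nonnegative on
      [-1, 1], because [x . x_0] takes every value in (-1, 1)
      ([design_wint_gt0]).  The classical arguments then place the nodes and
      give [tau_j > 0].
    - The potential may be infinite at the ends of the interval.  For [nu = 1]
      the node -1 is harmless: an odd derivative that is nonnegative forces
      [f(-1) < +oo] ([odd_deriv_ge0_finite]). *)

(** * Improper integrals on a bounded open interval *)

Definition gap (R : realType) (a b : R) (k : nat) : R :=
  (b - a) * harmonic k.+2.
Arguments gap : simpl never.

(** An exhausting sequence of compact intervals: the theorem of calculus holds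
    on each of them, also when the integrand is unbounded near [a] or [b]. *)
Definition shrunk (R : realType) (a b : R) (k : nat) : set R :=
  `[a + gap a b k, b - gap a b k].

Lemma gap_bounds (R : realType) (a b : R) k : a < b ->
  0 < gap a b k < (b - a) / 2.
Proof.
move=> ab; have ba : 0 < b - a by rewrite subr_gt0.
rewrite /gap pmulr_rgt0 // ltr_pM2l // /= invr_gt0 ltr0n /=.
by rewrite ltf_pV2 ?posrE ?ltr0n // ltr_nat.
Qed.

Lemma shrunk_lt (R : realType) (a b : R) k : a < b ->
  [/\ a < a + gap a b k, b - gap a b k < b & a + gap a b k < b - gap a b k].
Proof. by move=> /(gap_bounds k) /andP[h0 h1]; split; lra. Qed.

Lemma shrunk_sub (R : realType) (a b : R) k : a < b ->
  shrunk a b k `<=` `]a, b[.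
Proof.
move=> ab t; have [h1 h2 _] := shrunk_lt k ab.
rewrite /shrunk /= !in_itv /= => /andP[t1 t2].
by rewrite (lt_le_trans h1 t1) (le_lt_trans t2 h2).
Qed.

Lemma shrunk_nondecreasing (R : realType) (a b : R) : a < b ->
  nondecreasing_seq (shrunk a b).
Proof.
move=> ab k l kl; rewrite subsetEset => t; rewrite /shrunk /= !in_itv /=.
have : gap a b l <= gap a b k.
  rewrite /gap ler_pM2l ?subr_gt0 //= lef_pV2 ?posrE ?ltr0n //.
  by rewrite ler_nat !ltnS.
by move=> hh /andP[t1 t2]; apply/andP; split; lra.
Qed.

Lemma cvg_gap (R : realType) (a b : R) : gap a b k @[k --> \oo] --> 0.
Proof.
rewrite -(mulr0 (b - a)); apply: cvgMr.
have := @cvg_harmonic R; rewrite -(cvg_shiftn 2).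
by under eq_fun do rewrite addn2.
Qed.

Lemma near_shrunk (R : realType) (a b t : R) : a < t < b ->
  \forall k \near \oo, shrunk a b k t.
Proof.
move=> /andP[at_ tb]; have ab := lt_trans at_ tb.
have e0 : 0 < Num.min (t - a) (b - t) by rewrite lt_min !subr_gt0 at_ tb.
have /cvgrPdist_lt/(_ _ e0) := cvg_gap a b; apply: filterS => k.
have /andP[g0 _] := gap_bounds k ab.
rewrite sub0r normrN gtr0_norm // lt_min /shrunk /= in_itv /=.
by move=> /andP[h1 h2]; apply/andP; split; lra.
Qed.

Lemma bigcup_shrunk (R : realType) (a b : R) : a < b ->
  \bigcup_k shrunk a b k = `]a, b[%classic.
Proof.
move=> ab; apply/seteqP; split=> [t [k _]|t]; first exact: shrunk_sub.
rewrite /= in_itv /= => /near_shrunk[K _ hK].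
by exists K => //; apply: hK => /=.
Qed.

Lemma shrunk_FTC (R : realType) (f F : R -> R) (a b : R) k : a < b ->
  (forall t, a < t < b -> {for t, continuous f}) ->
  (forall t, a < t < b -> is_derive t 1 F (f t)) ->
  (\int[lebesgue_measure]_(t in shrunk a b k) (f t)%:E =
   (F (b - gap a b k))%:E
   - (F (a + gap a b k))%:E)%E.
Proof.
move=> ab cf dF; have [h1 h2 h3] := shrunk_lt k ab.
set a' := a + _ in h1 h3 *; set b' := b - _ in h2 h3 *.
have sub t : t \in `[a', b'] -> a < t < b.
  rewrite in_itv /= => /andP[t1 t2].
  by rewrite (lt_le_trans h1 t1) (le_lt_trans t2 h2).
have cc (g : R -> R) (cg : forall t, a < t < b -> {for t, continuous g}) :
    {within `[a', b'], continuous g}.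
  apply/continuous_in_subspaceT => t /set_mem /= tI.
  by apply: cg; exact: sub.
have dcont t : a < t < b -> {for t, continuous F}.
  by move=> /dF[dt _]; apply/differentiable_continuous/derivable1_diffP.
apply: continuous_FTC2 => //; first exact: cc.
  split.
  - move=> t tI; have [] // := dF t (sub t (subset_itv_oo_cc tI)).
  - by have /(continuous_within_itvP _ h3)[] := cc _ dcont.
  - by have /(continuous_within_itvP _ h3)[] := cc _ dcont.
move=> t tI; rewrite derive1E.
by have [_ ->] := dF t (sub t (subset_itv_oo_cc tI)).
Qed.

Lemma itvoo_continuous_measurable (R : realType) (f : R -> R) (a b : R) :
  (forall t, a < t < b -> {for t, continuous f}) ->
  measurable_fun `]a, b[ f.
Proof.
move=> cf; apply: open_continuous_measurable_fun; first exact: interval_open.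
by move=> t /set_mem /= tI; apply: cf; move: tI; rewrite in_itv.
Qed.

Lemma shrunk_measurable (R : realType) (a b : R) k :
  measurable (shrunk a b k).
Proof. exact: measurable_itv. Qed.

(** By monotone convergence: the integrals over the compact intervals are
    increments of the bounded antiderivative [F], hence at most [2 * M]. *)
Lemma ge0_improper_integrable (R : realType) (f F : R -> R) (a b M : R) :
  a < b ->
  (forall t, a < t < b -> {for t, continuous f}) ->
  (forall t, a < t < b -> is_derive t 1 F (f t)) ->
  (forall t, a < t < b -> 0 <= f t) ->
  (forall t, a < t < b -> `|F t| <= M) ->
  (@lebesgue_measure R).-integrable `]a, b[ (EFin \o f).
Proof.
move=> ab cf dF f0 FM.
have mf := itvoo_continuous_measurable cf.
apply/integrableP; split; first exact/measurable_EFinP.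
under eq_integral => t.
  rewrite inE /= in_itv /= => tI.
  rewrite ger0_norm ?f0 //; over.
rewrite -bigcup_shrunk //.
have mfk k : measurable_fun (shrunk a b k) (EFin \o f).
  apply/measurable_EFinP; apply: measurable_funS mf => //.
  exact: shrunk_sub.
have fk0 k t : shrunk a b k t -> (0 <= (EFin \o f) t)%E.
  by move=> /(shrunk_sub ab) /=; rewrite in_itv /= lee_fin => /f0.
have nd := shrunk_nondecreasing ab.
have ic : (\int[lebesgue_measure]_(t in shrunk a b k) (f t)%:E)%E @[k --> \oo]
    --> (\int[lebesgue_measure]_(t in \bigcup_k shrunk a b k) (f t)%:E)%E.
  by apply: ge0_nondecreasing_set_cvg_integral => //; exact: shrunk_measurable.
rewrite -(cvg_lim _ ic) //.
apply: (@le_lt_trans _ _ (2 * M)%:E); last exact: ltry.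
apply: lime_le; first by apply/cvg_ex; eexists; exact: ic.
apply: nearW => k; rewrite (shrunk_FTC _ ab cf dF) -EFinB lee_fin.
have [h1 h2 h3] := shrunk_lt k ab.
set a' := a + _ in h1 h3 *; set b' := b - _ in h2 h3 *.
have : `|F a'| <= M by apply: FM; rewrite h1 (lt_trans h3).
have : `|F b'| <= M by apply: FM; rewrite h2 (lt_trans _ h3).
rewrite !ler_norml => /andP[? ?] /andP[? ?]; lra.
Qed.

(** By dominated convergence along the compact intervals, with [|f|] as the
    dominating function. *)
Lemma improper_FTC (R : realType) (f F : R -> R) (a b la lb : R) :
  a < b ->
  (forall t, a < t < b -> {for t, continuous f}) ->
  (forall t, a < t < b -> is_derive t 1 F (f t)) ->
  (@lebesgue_measure R).-integrable `]a, b[ (EFin \o f) ->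
  F t @[t --> a^'+] --> la -> F t @[t --> b^'-] --> lb ->
  \int[lebesgue_measure]_(t in `]a, b[) f t = lb - la.
Proof.
move=> ab cf dF intf Fa Fb.
have mf := itvoo_continuous_measurable cf.
pose mu := @lebesgue_measure R.
pose fk k : R -> \bar R := (EFin \o f) \_ (shrunk a b k).
have [] := @dominated_convergence _ _ R mu `]a, b[ (measurable_itv _)
  fk (EFin \o f) (abse \o (EFin \o f)).
- move=> k; apply/measurable_restrict => //; first exact: shrunk_measurable.
  by apply/measurable_EFinP; apply: measurable_funS mf => //; exact: subIsetl.
- exact/measurable_EFinP.
- apply/aeW => t /=; rewrite in_itv /= => /near_shrunk tI.
  apply: cvg_near_cst; apply: filterS tI => k tk.
  by rewrite /fk patchE mem_set.
- exact: integrable_abse.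
- apply/aeW => t k _; rewrite /fk patchE; case: ifP => //= _.
  by rewrite normr0 lee_fin.
move=> _ _ dc.
have Ik k : (\int[mu]_(x in `]a, b[) fk k x)%E =
   ((F (b - gap a b k))
   - (F (a + gap a b k)))%:E.
  rewrite -integral_mkcondr setIidr; last exact: shrunk_sub.
  by rewrite (shrunk_FTC _ ab cf dF).
have h0 := cvg_gap a b.
have cb : F (b - gap a b k) @[k --> \oo] --> lb.
  move/cvg_at_leftP : Fb; apply; split; last first.
    by rewrite -[X in _ --> X]subr0; apply: cvgB => //; exact: cvg_cst.
  by move=> k; have [] := shrunk_lt k ab.
have ca : F (a + gap a b k) @[k --> \oo] --> la.
  move/cvg_at_rightP : Fa; apply; split; last first.
    by rewrite -[X in _ --> X]addr0; apply: cvgD => //; exact: cvg_cst.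
  by move=> k; have [] := shrunk_lt k ab.
rewrite /Rintegral.
have -> : (\int[mu]_(x in `]a, b[) (f x)%:E)%E = (lb - la)%:E.
  have E : (fun k => (\int[mu]_(x in `]a, b[) fk k x)%E) = 
     EFin \o (fun k => F (b - gap a b k)
       - F (a + gap a b k)).
    by apply/funext => k; rewrite Ik.
  rewrite -(cvg_lim _ dc) // E; apply/cvg_lim => //.
  by apply: cvg_EFin; [exact: nearW | exact: cvgB].
by [].
Qed.

(** * Moments of the Gegenbauer weight *)

Lemma onemX2_bounds (R : realType) (t : R) : -1 < t < 1 -> 0 < 1 - t ^+ 2 <= 1.
Proof. by move=> /andP[t1 t2]; apply/andP; split; nra. Qed.

Lemma integrable_itvoo_cc (R : realType) (f : R -> R) (a b : R) :
  (@lebesgue_measure R).-integrable `]a, b[ (EFin \o f) ->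
  (@lebesgue_measure R).-integrable `[a, b] (EFin \o f).
Proof.
move=> /integrableP[mf intf]; apply/integrableP; split.
  apply/emeasurable_fun_itv_obnd_cbndP.
  exact/emeasurable_fun_itv_bndo_bndcP.
rewrite integral_itv_bndoo //; exact: measurableT_comp.
Qed.

Lemma Rintegral_itvoo_cc (R : realType) (f : R -> R) (a b : R) :
  (@lebesgue_measure R).-integrable `]a, b[ (EFin \o f) ->
  \int[lebesgue_measure]_(t in `[a, b]) f t =
  \int[lebesgue_measure]_(t in `]a, b[) f t.
Proof.
move=> /integrableP[mf _]; rewrite /Rintegral integral_itv_bndoo //.
Qed.

Lemma wn_unnorm_ge0 (R : realType) (n : nat) (t : R) : 0 <= wn_unnorm n t.
Proof. exact: powR_ge0. Qed.

Lemma is_derive_wn_unnorm (R : realType) (n : nat) (t : R) : -1 < t < 1 ->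
  is_derive t 1 (wn_unnorm n)
    ((n%:R - 3) / 2 * (1 - t ^+ 2) `^ ((n%:R - 3) / 2 - 1)
      * (1 - 'X ^+ 2)^`().[t]).
Proof.
move=> /onemX2_bounds/andP[t0 _].
have -> : wn_unnorm n = (@powR R ^~ ((n%:R - 3) / 2)) \o horner (1 - 'X ^+ 2).
  by apply/funext => s /=; rewrite /wn_unnorm !hornerE.
have E : (1 - 'X ^+ 2 : {poly R}).[t] = 1 - t ^+ 2 by rewrite !hornerE.
by apply: is_derive1_comp; rewrite E; exact: is_derive1_powR.
Qed.

Lemma continuous_wn_unnorm (R : realType) (n : nat) (t : R) : -1 < t < 1 ->
  {for t, continuous (wn_unnorm n)}.
Proof.
move=> /(is_derive_wn_unnorm n)[dt _].
exact/differentiable_continuous/derivable1_diffP.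
Qed.

(** The case [n = 2], where the weight is unbounded at both ends: it is the
    derivative of the bounded function [asin]. *)
Lemma asin_derive_integrable (R : realType) :
  (@lebesgue_measure R).-integrable `]-1, 1[
    (EFin \o (fun t => (Num.sqrt (1 - t ^+ 2))^-1)).
Proof.
apply: (@ge0_improper_integrable R (fun t => (Num.sqrt (1 - t ^+ 2))^-1)
  (@asin R) _ _ (pi / 2)).
- by lra.
- move=> t /onemX2_bounds/andP[t0 _].
  apply: cvgV; first by rewrite gt_eqF // sqrtr_gt0.
  apply: continuous_cvg; first exact: sqrt_continuous.
  by apply: cvgB; [exact: cvg_cst | exact: exprn_continuous].
- by move=> t _; rewrite invr_ge0 sqrtr_ge0.
move=> t /andP[t1 t2]; have tI : -1 <= t <= 1 by rewrite !ltW.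
by rewrite ler_norml asin_geNpi2 ?asin_lepi2.
Qed.

(** As [0 < 1 - t^2 <= 1], smaller exponents give larger powers, so the weight
    for [n = 2] dominates all others. *)
Lemma wn_unnorm_le_asin_derive (R : realType) (n : nat) (t : R) :
  (2 <= n)%N -> -1 < t < 1 ->
  wn_unnorm n t <= (Num.sqrt (1 - t ^+ 2))^-1.
Proof.
move=> n2 /onemX2_bounds t0; rewrite /wn_unnorm.
have h0 : 0 <= 1 - t ^+ 2 by case/andP: t0 => /ltW.
rewrite -powR12_sqrt // -powRN; apply: ger_powR => //.
have : (2 : R) <= n%:R by rewrite ler_nat.
by move=> ?; lra.
Qed.

Lemma horner_norm_le (R : realType) (p : {poly R}) (t : R) : -1 <= t <= 1 ->
  `|p.[t]| <= \sum_(i < size p) `|p`_i|.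
Proof.
move=> t1; rewrite horner_coef; apply: (le_trans (ler_norm_sum _ _ _)).
apply: ler_sum => i _; rewrite normrM ler_piMr // normrX.
by rewrite exprn_ile1 // ler_norml.
Qed.

Lemma horner_wn_unnorm_integrable (R : realType) (n : nat) (p : {poly R}) :
  (2 <= n)%N ->
  (@lebesgue_measure R).-integrable `]-1, 1[
    (EFin \o (fun t => p.[t] * wn_unnorm n t)).
Proof.
move=> n2; set M := \sum_(i < size p) `|p`_i|.
have M0 : 0 <= M by apply: sumr_ge0.
have iM : (@lebesgue_measure R).-integrable `]-1, 1[
    (fun t => M%:E * ((Num.sqrt (1 - t ^+ 2))^-1)%:E)%E.
  by apply: integrableZl => //; exact: asin_derive_integrable.
apply: le_integrable iM => //.
  apply/measurable_EFinP; apply: itvoo_continuous_measurable => t tI.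
  by apply: cvgM; [exact: continuous_horner | exact: continuous_wn_unnorm].
move=> t /=; rewrite in_itv /= => tI; rewrite lee_fin !normrM.
rewrite (ger0_norm M0) (ger0_norm (wn_unnorm_ge0 _ _)).
rewrite [X in _ <= _ * X]ger0_norm ?invr_ge0 ?sqrtr_ge0 //.
apply: ler_pM => //; first exact: wn_unnorm_ge0.
  by apply: horner_norm_le; case/andP: tI => /ltW -> /ltW ->.
exact: wn_unnorm_le_asin_derive.
Qed.

(** The integrand is the derivative of [(1 - t^2) p(t) (1 - t^2)^((n-3)/2)],
    which is at most a multiple of [sqrt (1 - t^2)] and so tends to 0 at both
    ends. *)
Lemma wn_unnorm_stokes (R : realType) (n : nat) (p : {poly R}) : (2 <= n)%N ->
  \int[lebesgue_measure]_(t in `]-1, 1[)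
    (((1 - 'X ^+ 2) * p^`() - (n%:R - 1) *: ('X * p)).[t] * wn_unnorm n t) = 0.
Proof.
move=> n2; set q := _ - _.
pose F := horner ((1 - 'X ^+ 2) * p) \* wn_unnorm n.
pose M (t : R) := (\sum_(i < size p) `|p`_i|) * Num.sqrt (1 - t ^+ 2).
have F0 (t : R) : -1 < t < 1 -> `|F t| <= M t.
  move=> tI; have /andP[u0 _] := onemX2_bounds tI.
  rewrite /F /= !hornerE [X in `|X * _|]mulrC -mulrA normrM.
  apply: ler_pM => //.
    by apply: horner_norm_le; case/andP: tI => /ltW -> /ltW ->.
  rewrite ger0_norm ?mulr_ge0 ?wn_unnorm_ge0 ?(ltW u0) //.
  apply: le_trans (ler_wpM2l (ltW u0) (wn_unnorm_le_asin_derive n2 tI)) _.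
  rewrite -[X in X / _]sqr_sqrtr ?(ltW u0) // expr2 mulfK //.
  by rewrite gt_eqF ?sqrtr_gt0.
have M0 : M t @[t --> (-1 : R)] --> (0 : R) /\ M t @[t --> (1 : R)] --> (0 : R).
  have Mc : continuous M.
    move=> t; apply: cvgMr.
    apply: continuous_cvg; first exact: sqrt_continuous.
    by apply: cvgB; [exact: cvg_cst | exact: exprn_continuous].
  have M1 : M (-1) = 0 by rewrite /M sqrrN expr1n subrr sqrtr0 mulr0.
  have M1' : M 1 = 0 by rewrite /M expr1n subrr sqrtr0 mulr0.
  by split; [rewrite -M1 | rewrite -M1']; exact: Mc.
rewrite -[RHS](subrr 0); apply: (@improper_FTC _ _ F).
- by lra.
- move=> t tI; apply: cvgM; first exact: continuous_horner.
  exact: continuous_wn_unnorm.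
- move=> t tI; have /andP[u0 _] := onemX2_bounds tI.
  have dw := is_derive_wn_unnorm n tI.
  apply: is_derive_eq.
  rewrite /wn_unnorm; set a := (n%:R - 3) / 2.
  have -> : (1 - t ^+ 2) `^ a = (1 - t ^+ 2) * (1 - t ^+ 2) `^ (a - 1).
    rewrite -[X in X * _]powRr1 ?(ltW u0) // -powRD.
      by congr (_ `^ _); ring.
    by rewrite (gt_eqF u0) implybT.
  rewrite /q !poly.derivE !hornerE /= /GRing.scale /= /a.
  by field.
- exact: horner_wn_unnorm_integrable.
- have F01 : \forall t \near (-1 : R)^'+, - M t <= F t <= M t.
    near=> t; rewrite -ler_norml; apply: F0; apply/andP; split.
      by near: t; exact: nbhs_right_gt.
    by near: t; apply: nbhs_right_lt; lra.
  have [M1 _] := M0.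
  apply: (squeeze_cvgr F01); last exact: cvg_at_right_filter.
  by rewrite -oppr0; apply: cvgN; exact: cvg_at_right_filter.
have F01 : \forall t \near (1 : R)^'-, - M t <= F t <= M t.
  near=> t; rewrite -ler_norml; apply: F0; apply/andP; split; last first.
    by near: t; exact: nbhs_left_lt.
  by near: t; apply: nbhs_left_gt; lra.
have [_ M1] := M0.
apply: (squeeze_cvgr F01); last exact: cvg_at_left_filter.
by rewrite -oppr0; apply: cvgN; exact: cvg_at_left_filter.
Unshelve. all: by end_near. Qed.

Lemma wn_unnorm_integrable (R : realType) (n : nat) : (2 <= n)%N ->
  (@lebesgue_measure R).-integrable `]-1, 1[ (EFin \o wn_unnorm n).
Proof.
move=> n2; have := horner_wn_unnorm_integrable (1 : {poly R}) n2.
have -> // : (fun t : R => (1 : {poly R}).[t] * wn_unnorm n t) = wn_unnorm n.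
by apply/funext => t; rewrite hornerE mul1r.
Qed.

(** Makes the normalization by the mass meaningful: the inverse of 0 is 0, so
    [wint n] would be identically 0 if the mass vanished. *)
Lemma wn_mass_gt0 (R : realType) (n : nat) : (2 <= n)%N ->
  0 < \int[lebesgue_measure]_(s in `[(-1 : R), 1]) wn_unnorm n s.
Proof.
move=> n2; set D := `[(-1 : R), 1]%classic.
pose J := `[(- 2^-1 : R), 2^-1]%classic.
have iw : (@lebesgue_measure R).-integrable D (EFin \o wn_unnorm n).
  by apply: integrable_itvoo_cc; exact: wn_unnorm_integrable.
have JD : J `<=` D.
  move=> t; rewrite /J /D /= !in_itv /= => /andP[? ?].
  by apply/andP; split; lra.
have mJw : measurable_fun J (EFin \o wn_unnorm n).
  apply: (measurable_funS _ JD); first exact: measurable_itv.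
  exact: measurable_int iw.
(* On [J] the base is at least 3/4, and the exponent is at most [n]. *)
pose c : R := (3 / 4) ^+ n.
have c0 : 0 < c by rewrite exprn_gt0 //; lra.
have wc t : J t -> c <= wn_unnorm n t.
  rewrite /J /= in_itv /= => /andP[t1 t2].
  have u1 : 3 / 4 <= 1 - t ^+ 2 by nra.
  have u2 : 0 < 1 - t ^+ 2 <= 1 by apply/andP; split; nra.
  apply: (@le_trans _ _ ((1 - t ^+ 2) ^+ n)).
    by apply: lerXn2r; rewrite ?nnegrE //; lra.
  rewrite -powR_mulrn; last by case/andP: u2 => /ltW.
  apply: ger_powR => //.
  by have : (0 : R) <= n%:R by []; lra.
apply: (lt_le_trans c0).
have mJ : lebesgue_measure J = 1%:E.
  rewrite [LHS](@lebesgue_measure_itv R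
    (`[(- 2^-1 : R), (2^-1 : R)] : interval R)) /=.
  rewrite lte_fin; case: ifPn => [_|/negP[]]; last by lra.
  by rewrite -EFinD; congr (_%:E); lra.
rewrite -lee_fin /Rintegral fineK; last first.
  by apply: integrable_fin_num => //; exact: measurable_itv.
have -> : c%:E = (\int[lebesgue_measure]_(s in J) c%:E)%E.
  rewrite integral_cst /= ?[X in (_ * X)%E]mJ ?mule1 //.
  exact: measurable_itv.
apply: (@le_trans _ _ (\int[lebesgue_measure]_(s in J) (wn_unnorm n s)%:E)%E).
  apply: ge0_le_integral.
  - exact: measurable_itv.
  - by move=> t _; rewrite lee_fin ltW.
  - exact: measurable_cst.
  - exact: mJw.
  - by move=> t Jt; rewrite lee_fin wc.
apply: ge0_subset_integral => //; try exact: measurable_itv.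
  exact: measurable_int iw.
by move=> t _; rewrite lee_fin wn_unnorm_ge0.
Qed.

Lemma wintE (R : realType) (n : nat) (p : {poly R}) : (2 <= n)%N ->
  wint n p =
  (\int[lebesgue_measure]_(s in `[(-1 : R), 1]) wn_unnorm n s)^-1
    * \int[lebesgue_measure]_(t in `]-1, 1[) (p.[t] * wn_unnorm n t).
Proof.
move=> n2; have ip := horner_wn_unnorm_integrable p n2.
rewrite /wint -Rintegral_itvoo_cc // -RintegralZl //.
  by under eq_Rintegral do rewrite /wn mulrCA.
exact: integrable_itvoo_cc.
Qed.

Lemma wint_stokes (R : realType) (n : nat) (p : {poly R}) : (2 <= n)%N ->
  wint n ((1 - 'X ^+ 2) * p^`() - (n%:R - 1) *: ('X * p)) = 0.
Proof. by move=> n2; rewrite wintE // wn_unnorm_stokes // mulr0. Qed.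

Lemma wint1 (R : realType) (n : nat) : (2 <= n)%N ->
  wint n (1 : {poly R}) = 1.
Proof.
move=> n2; have Z0 := wn_mass_gt0 R n2.
rewrite wintE //.
have -> : \int[lebesgue_measure]_(t in `]-1, 1[)
    ((1 : {poly R}).[t] * wn_unnorm n t) =
  \int[lebesgue_measure]_(t in `]-1, 1[) wn_unnorm n t.
  by apply: eq_Rintegral => t _; rewrite hornerE mul1r.
rewrite -Rintegral_itvoo_cc ?mulVf ?gt_eqF //.
exact: wn_unnorm_integrable.
Qed.

Lemma wintD (R : realType) (n : nat) (p q : {poly R}) : (2 <= n)%N ->
  wint n (p + q) = wint n p + wint n q.
Proof.
move=> n2; rewrite !wintE // -mulrDr; congr (_ * _).
rewrite -RintegralD //; try exact: horner_wn_unnorm_integrable.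
by apply: eq_Rintegral => t _; rewrite hornerD mulrDl.
Qed.

Lemma wintZ (R : realType) (n : nat) (a : R) (p : {poly R}) : (2 <= n)%N ->
  wint n (a *: p) = a * wint n p.
Proof.
move=> n2; rewrite !wintE // mulrCA; congr (_ * _).
rewrite -RintegralZl //; last exact: horner_wn_unnorm_integrable.
by apply: eq_Rintegral => t _; rewrite hornerZ mulrA.
Qed.

Lemma wint_sum (R : realType) (n : nat) (I : Type) (s : seq I)
    (F : I -> {poly R}) : (2 <= n)%N ->
  wint n (\sum_(i <- s) F i) = \sum_(i <- s) wint n (F i).
Proof.
move=> n2; elim: s => [|i s IH]; last by rewrite !big_cons wintD // IH.
by rewrite !big_nil -(scale0r 0) wintZ // mul0r.
Qed.

(** The preceding identity for ['X^j].  At [j = 0] it says that the first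
    moment vanishes, the truncated exponent being multiplied by 0. *)
Lemma wint_moment (R : realType) (n j : nat) : (2 <= n)%N ->
  (n%:R - 1 + j%:R) * wint n 'X^(j.+1) = j%:R * wint n ('X^(j.-1) : {poly R}).
Proof.
move=> n2; have := wint_stokes ('X^j : {poly R}) n2.
have -> : (1 - 'X ^+ 2) * ('X^j)^`() - (n%:R - 1) *: ('X * 'X^j) =
   j%:R *: 'X^(j.-1) + (- (n%:R - 1 + j%:R)) *: 'X^(j.+1) :> {poly R}.
  rewrite derivXn -scaler_nat.
  case: j => [|j] /=; first by rewrite -!mul_polyC !rmorphE /=; ring.
  rewrite -!mul_polyC !exprS.
  set c : {poly R} := _%:P; set d : {poly R} := _%:P.
  by rewrite !polyCN !polyCD !polyCN -/c; ring.
by rewrite wintD // !wintZ // => /eqP; rewrite mulNr subr_eq0 => /eqP.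
Qed.

(** * The dot product and the sphere *)

Lemma dotpC (R : realType) (n : nat) (x y : 'rV[R]_n) : dotp x y = dotp y x.
Proof. by apply: eq_bigr => i _; rewrite mulrC. Qed.

Lemma dotpDl (R : realType) (n : nat) (x y z : 'rV[R]_n) :
  dotp (x + y) z = dotp x z + dotp y z.
Proof. by rewrite -big_split; apply: eq_bigr => i _; rewrite !mxE mulrDl. Qed.

Lemma dotpZl (R : realType) (n : nat) (a : R) (x z : 'rV[R]_n) :
  dotp (a *: x) z = a * dotp x z.
Proof. by rewrite mulr_sumr; apply: eq_bigr => i _; rewrite !mxE mulrA. Qed.

Lemma dotp0l (R : realType) (n : nat) (z : 'rV[R]_n) : dotp 0 z = 0.
Proof. by rewrite -(scale0r z) dotpZl mul0r. Qed.

Lemma dotpDr (R : realType) (n : nat) (x y z : 'rV[R]_n) :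
  dotp z (x + y) = dotp z x + dotp z y.
Proof. by rewrite !(dotpC z) dotpDl. Qed.

Lemma dotpZr (R : realType) (n : nat) (a : R) (x z : 'rV[R]_n) :
  dotp z (a *: x) = a * dotp z x.
Proof. by rewrite !(dotpC z) dotpZl. Qed.

Lemma dotpNl (R : realType) (n : nat) (x z : 'rV[R]_n) :
  dotp (- x) z = - dotp x z.
Proof. by rewrite -scaleN1r dotpZl mulN1r. Qed.

Lemma dotpNr (R : realType) (n : nat) (x z : 'rV[R]_n) :
  dotp z (- x) = - dotp z x.
Proof. by rewrite !(dotpC z) dotpNl. Qed.

Lemma dotp_delta (R : realType) (n : nat) (k : 'I_n) (x : 'rV[R]_n) :
  dotp (delta_mx 0 k) x = x 0 k.
Proof.
rewrite /dotp (bigD1 k) //= mxE !eqxx mul1r big1 ?addr0 // => i ik.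
by rewrite mxE (negbTE ik) andbF mul0r.
Qed.

Lemma dotp_ge0 (R : realType) (n : nat) (x : 'rV[R]_n) : 0 <= dotp x x.
Proof. by apply: sumr_ge0 => i _; rewrite -expr2 sqr_ge0. Qed.

Lemma dotp_eq0 (R : realType) (n : nat) (x : 'rV[R]_n) :
  dotp x x = 0 -> x = 0.
Proof.
move=> /eqP; rewrite psumr_eq0 => [/allP h|i _]; last by rewrite -expr2 sqr_ge0.
apply/rowP => i; have := h i (mem_index_enum i).
by rewrite /= mulf_eq0 orbb mxE => /eqP.
Qed.

Lemma dotp_unit_bounds (R : realType) (n : nat) (x y : 'rV[R]_n) :
  unit_sphere x -> unit_sphere y -> -1 <= dotp x y <= 1.
Proof.
rewrite /unit_sphere /= => x1 y1.
have := dotp_ge0 (x + y); have := dotp_ge0 (x - y).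
rewrite !(dotpDl, dotpDr, dotpNl, dotpNr) x1 y1 (dotpC y x) => h1 h2.
by apply/andP; split; lra.
Qed.

(** The equality case of Cauchy-Schwarz: [|x + y|^2 = 2 + 2 (x . y) = 0]. *)
Lemma dotp_unit_eqN1 (R : realType) (n : nat) (x y : 'rV[R]_n) :
  unit_sphere x -> unit_sphere y -> dotp x y = -1 -> x = - y.
Proof.
rewrite /unit_sphere /= => x1 y1 xy.
apply/eqP; rewrite -addr_eq0; apply/eqP/dotp_eq0.
by rewrite !(dotpDl, dotpDr) x1 y1 (dotpC y x) xy; ring.
Qed.

Lemma dotp_delta_unit (R : realType) (n : nat) (k : 'I_n) :
  unit_sphere (delta_mx 0 k : 'rV[R]_n).
Proof. by rewrite /unit_sphere /= dotp_delta mxE !eqxx. Qed.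


Lemma exists_orthogonal_unit (R : realType) (n : nat) (u : 'rV[R]_n) :
  (2 <= n)%N -> exists2 e : 'rV[R]_n, unit_sphere e & dotp e u = 0.
Proof.
case: n u => [|[|n]] // u _.
suff [v v0 vu] : exists2 v : 'rV[R]_n.+2, dotp v v != 0 & dotp v u = 0.
  have v1 : 0 < dotp v v by rewrite lt_def v0 dotp_ge0.
  exists ((Num.sqrt (dotp v v))^-1 *: v); last by rewrite dotpZl vu mulr0.
  rewrite /unit_sphere /= dotpZl dotpZr mulrA -invfM -expr2 sqr_sqrtr ?ltW //.
  by rewrite mulVf.
pose i0 : 'I_n.+2 := ord0; pose i1 : 'I_n.+2 := ord_max.
have [u0|u0] := eqVneq (u 0 i0) 0.
  exists (delta_mx 0 i0); last by rewrite dotp_delta.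
  by rewrite (dotp_delta_unit R i0 : dotp _ _ = 1) oner_neq0.
exists (u 0 i1 *: delta_mx 0 i0 - u 0 i0 *: delta_mx 0 i1).
  apply/eqP => /dotp_eq0 /rowP /(_ i1) /eqP.
  rewrite !mxE !eqxx (_ : (i1 == i0) = false) // !andbF !mulr0 mulr1 sub0r.
  by rewrite oppr_eq0 (negbTE u0).
by rewrite dotpDl dotpNl !dotpZl !dotp_delta mulrC subrr.
Qed.

(** On the circle spanned by [u] and an orthogonal unit vector [e], take the
    point with coordinates [t] and [sqrt (1 - t^2)]. *)
Lemma exists_dotp_eq (R : realType) (n : nat) (u : 'rV[R]_n) (t : R) :
  (2 <= n)%N -> unit_sphere u -> -1 < t < 1 ->
  exists2 y : 'rV[R]_n, unit_sphere y & dotp y u = t.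
Proof.
move=> n2 u1 t1; have [e e1 eu] := exists_orthogonal_unit u n2.
have ue : dotp u e = 0 by rewrite dotpC.
have /andP[t0 _] := onemX2_bounds t1.
exists (t *: u + Num.sqrt (1 - t ^+ 2) *: e).
  rewrite /unit_sphere /= !(dotpDl, dotpDr, dotpZl, dotpZr) eu ue u1 e1.
  rewrite !mulr0 !mulr1 addr0 add0r -!expr2 sqr_sqrtr ?(ltW t0) //.
  by rewrite addrC subrK.
by rewrite dotpDl !dotpZl eu u1 mulr1 mulr0 addr0.
Qed.

(** * Designs integrate polynomials exactly *)

Lemma second_deriv_exp0 (R : realType) (p : {poly R}) (j : nat) :
  ((p ^+ j.+2)^`()^`()).[0] =
  j.+2%:R * (j.+1%:R * p^`().[0] ^+ 2 * p.[0] ^+ j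
             + p^`()^`().[0] * p.[0] ^+ j.+1).
Proof.
have dX (k : nat) : (p ^+ k.+1)^`() = k.+1%:R *: (p^`() * p ^+ k).
  by rewrite deriv_exp scaler_nat.
rewrite dX linearZ /= derivM dX !hornerE /= !exprS.
by ring.
Qed.

Section DesignMoments.
Variables (R : realType) (n N : nat) (C : 'I_N -> 'rV[R]_n) (w : 'I_N -> R).
Hypothesis CS : forall i, unit_sphere (C i).

(** Antipodal points give opposite values. *)
Lemma odd_moment (j : nat) (c : R) (x : 'rV[R]_n) : odd j -> unit_sphere x ->
  (forall x, unit_sphere x -> \sum_(i < N) w i * dotp x (C i) ^+ j = c) ->
  c = 0.
Proof.
move=> oj x1 hc; have := hc (- x).
have -> : \sum_(i < N) w i * dotp (- x) (C i) ^+ j = - c.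
  rewrite -(hc x x1) -sumrN; apply: eq_bigr => i _.
  by rewrite dotpNl exprNn -signr_odd oj expr1 mulN1r mulrN.
have x1' : unit_sphere (- x) by rewrite /unit_sphere /= dotpNl dotpNr opprK.
by move=> /(_ x1') ?; lra.
Qed.

(** Both sides are homogeneous of degree [2h], so the identity extends from
    the sphere to the whole space, where it can be differentiated. *)
Lemma homogeneous_moment (h : nat) (c : R) : (0 < h)%N ->
  (forall x, unit_sphere x -> \sum_(i < N) w i * dotp x (C i) ^+ h.*2 = c) ->
  forall v : 'rV[R]_n,
    \sum_(i < N) w i * dotp v (C i) ^+ h.*2 = c * dotp v v ^+ h.
Proof.
move=> h0 hc v; have [/dotp_eq0 -> | v0] := eqVneq (dotp v v) 0.
  rewrite !dotp0l expr0n eqn0Ngt h0 mulr0 big1 // => i _.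
  by rewrite dotp0l expr0n double_eq0 eqn0Ngt h0 mulr0.
have v1 : 0 < dotp v v by rewrite lt_def v0 dotp_ge0.
set r := Num.sqrt (dotp v v).
have r2 : r ^+ 2 = dotp v v by rewrite sqr_sqrtr // ltW.
have r0 : r != 0 by rewrite gt_eqF // sqrtr_gt0.
have u1 : unit_sphere (r^-1 *: v).
  rewrite /unit_sphere /= dotpZl dotpZr -r2.
  by rewrite expr2 mulKf // mulVf.
rewrite -(hc _ u1) mulr_suml; apply: eq_bigr => i _.
rewrite dotpZl -r2 -exprM mul2n exprMn -mulrA; congr (_ * _).
by rewrite mulrAC -exprMn mulVf // expr1n mul1r.
Qed.

(** The Laplacian at [x] of the identity [homogeneous_moment], computed as the
    sum over the coordinate directions [k] of the second derivative at [t = 0]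
    along [x + t e_k].  On the left the squared coordinates of each [C i] add up
    to 1 and leave the moment of order [2h]; on the right those of [x] do. *)
Lemma even_moment_step (h : nat) (c c' : R) (x : 'rV[R]_n) : unit_sphere x ->
  (forall x, unit_sphere x -> \sum_(i < N) w i * dotp x (C i) ^+ h.*2 = c) ->
  (forall x, unit_sphere x ->
     \sum_(i < N) w i * dotp x (C i) ^+ h.+1.*2 = c') ->
  (n%:R + h.*2%:R) * c' = (1 + h.*2%:R) * c.
Proof.
move=> x1 hc hc'; have hom := homogeneous_moment (ltn0Sn h) hc'.
(* [P k] and [Q k] are the two sides restricted to the line [x + t e_k]. *)
pose P k : {poly R} := \sum_(i < N) w i *:
  ((dotp x (C i))%:P + (C i 0 k)%:P * 'X) ^+ h.+1.*2.
pose Q (k : 'I_n) : {poly R} :=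
  c' *: (1 + (x 0 k *+ 2)%:P * 'X + 'X ^+ 2) ^+ h.+1.
have PQ k : horner (P k) = horner (Q k).
  apply/funext => t; have := hom (x + t *: delta_mx 0 k).
  rewrite /P /Q horner_sum !hornerE.
  rewrite !(dotpDl, dotpDr, dotpZl, dotpZr) (dotpC x) !dotp_delta.
  rewrite [delta_mx _ _ _ _]mxE !eqxx (x1 : dotp x x = 1) => E.
  transitivity (c' * (1 + t * x 0 k + (t * x 0 k + t * (t * 1))) ^+ h.+1).
    rewrite -E; apply: eq_bigr => i _; rewrite !hornerE.
    by rewrite dotpDl dotpZl dotp_delta [t * _]mulrC.
  by congr (_ * _ ^+ _); ring.
have d2 k : (P k)^`()^`().[0] = (Q k)^`()^`().[0].
  by rewrite !derivE PQ.
have dP k : (P k)^`()^`().[0] = \sum_(i < N) w i * (C i 0 k) ^+ 2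
     * dotp x (C i) ^+ h.*2 * ((h.+1.*2)%:R * (h.*2.+1)%:R).
  rewrite /P !linear_sum /= horner_sum; apply: eq_bigr => i _.
  rewrite doubleS !linearZ /= hornerZ second_deriv_exp0.
  rewrite !poly.derivE !hornerE /=. 
  by ring.
have dQ k : (Q k)^`()^`().[0] = c' * (h.+1%:R * (4 * h%:R * x 0 k ^+ 2 + 2)).
  rewrite /Q !linearZ /= hornerZ.
  case: (h) => [|h'].
    by rewrite expr1 !poly.derivE !hornerE /=; ring.
  have -> : 1 + (x 0 k *+ 2)%:P * 'X + 'X ^+ 2
      = 'X * ((x 0 k *+ 2)%:P + 'X) + 1 :> {poly R} by ring.
  by rewrite second_deriv_exp0 !poly.derivE !hornerE !expr1n /=; ring.
have sq (y : 'rV[R]_n) : unit_sphere y -> \sum_(k < n) y 0 k ^+ 2 = 1.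
  by move=> <-; apply: eq_bigr => k _; rewrite expr2.
have E : \sum_(k < n) (P k)^`()^`().[0] = \sum_(k < n) (Q k)^`()^`().[0].
  by apply: eq_bigr => k _; exact: d2.
move: E; rewrite (eq_bigr _ (fun k _ => dP k)) (eq_bigr _ (fun k _ => dQ k)).
rewrite exchange_big /=.
under eq_bigr => i _ do rewrite -!mulr_suml -mulr_sumr sq // mulr1.
rewrite -!mulr_suml hc // -!mulr_sumr big_split /= -mulr_sumr sq // mulr1.
rewrite sumr_const card_ord -mulr_natl doubleS => E.
have h0 : 2 * h.+1%:R != 0 :> R by rewrite mulf_neq0 // pnatr_eq0.
apply: (mulfI h0); move: E; rewrite -!mul2n => E.
apply: etrans (etrans (esym E) _); last by ring.
by ring.
Qed.
End DesignMoments.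

Lemma sum_hornerE (R : realType) (n : nat) (N : nat) (a w : 'I_N -> R)
    (p : {poly R}) :
  \sum_(i < N) w i * p.[a i] =
  \sum_(j < size p) p`_j * \sum_(i < N) w i * a i ^+ j.
Proof.
under eq_bigr => i _ do rewrite horner_coef mulr_sumr.
rewrite exchange_big; apply: eq_bigr => j _; rewrite mulr_sumr.
by apply: eq_bigr => i _; rewrite mulrCA.
Qed.

(** Both sides are linear in [p], agree on 1, and their moments satisfy the
    same two-step recursion. *)
Lemma design_wintE (R : realType) (n N k : nat) (C : 'I_N -> 'rV[R]_n)
    (w : 'I_N -> R) (p : {poly R}) (x : 'rV[R]_n) :
  (2 <= n)%N -> design k C w -> (size p <= k.+1)%N -> unit_sphere x ->
  \sum_(i < N) w i * p.[dotp x (C i)] = wint n p.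
Proof.
move=> n2 [[_ CS _ w1] des] sp x1.
have mom (j : nat) : (j <= k)%N -> exists c, forall y, unit_sphere y ->
    \sum_(i < N) w i * dotp y (C i) ^+ j = c.
  move=> jk; have [|c hc] := des 'X^j; first by rewrite size_polyXn.
  exists c => y y1; rewrite -(hc y y1); apply: eq_bigr => i _.
  by rewrite hornerXn.
have E (j : nat) : (j <= k)%N ->
    \sum_(i < N) w i * dotp x (C i) ^+ j = wint n 'X^j.
  elim/ltn_ind: j => j IH jk; have [c hc] := mom j jk; rewrite (hc x x1).
  case: j IH jk hc => [|j] IH jk hc.
    rewrite expr0 wint1 // -(hc x x1) -w1.
    by apply: eq_bigr => i _; rewrite expr0 mulr1.
  have Wj := @wint_moment R n j n2.
  have nj0 : n%:R - 1 + j%:R != 0 :> R.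
    have : (2 : R) <= n%:R by rewrite ler_nat.
    by have : (0 : R) <= j%:R by []; move=> ? ?; rewrite gt_eqF //; lra.
  apply: (mulfI nj0); rewrite Wj; have [oj|ej] := boolP (odd j); last first.
    rewrite (odd_moment _ x1 hc) ?mulr0 //.
    case: j ej {Wj nj0 hc} IH jk => [|j] ej IH jk; first by rewrite mul0r.
    rewrite /= -IH //; last exact: (ltnW (ltnW jk)).
    have [c0 hc0] := mom j (ltnW (ltnW jk)); rewrite (hc0 x x1).
    by rewrite (odd_moment _ x1 hc0) ?mulr0 //; move: ej; rewrite /= negbK.
  case: j oj {Wj nj0} IH jk hc => // j; rewrite /= => ej IH jk hc.
  have [c0 hc0] := mom j (ltnW (ltnW jk)).
  rewrite -IH //; last exact: (ltnW (ltnW jk)).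
  rewrite (hc0 x x1); have ej2 : j = j./2.*2 by rewrite even_halfK.
  have := @even_moment_step R n N C w CS j./2 c0 c x x1.
  rewrite doubleS -ej2 => /(_ hc0 hc) EE.
  rewrite (_ : n%:R - 1 + j.+1%:R = n%:R + j%:R); last by rewrite -natr1; ring.
  by rewrite EE -nat1r.
rewrite sum_hornerE // -[in RHS](coefK p) poly_def wint_sum //.
apply: eq_bigr => j _; rewrite wintZ // E //.
by rewrite -ltnS (leq_trans (ltn_ord j) sp).
Qed.

Lemma exists_uniq_seq_itv01 (R : realType) (d : nat) :
  exists s : seq R, [/\ uniq s, size s = d & {in s, forall y, 0 < y < 1}].
Proof.
exists [seq harmonic i.+1 | i <- iota 0 d]; split.
- rewrite map_inj_uniq ?iota_uniq // => i j /= /invr_inj /eqP.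
  by rewrite eqr_nat => /eqP [].
- by rewrite size_map size_iota.
move=> y /mapP[i _ ->] /=; rewrite invr_gt0 ltr0n /= invf_lt1 ?ltr0n //.
by rewrite ltr1n.
Qed.

Lemma exists_nonroot (R : realType) (p : {poly R}) : p != 0 ->
  exists2 t, -1 < t < 1 & p.[t] != 0.
Proof.
move=> p0; have [s [us ss sI]] := exists_uniq_seq_itv01 R (size p).
have [/(max_poly_roots p0)/(_ us)|] := boolP (all (root p) s).
  by rewrite ss ltnn.
rewrite -has_predC => /hasP[t /sI /andP[t0 t1] rt]; exists t => //.
by rewrite t1 (lt_trans _ t0) // ltrN10.
Qed.

(** It is enough that one term of the design sum is positive for one [y]: the
    dot product of [y] with the first code point can be made to avoid the
    finitely many roots of [p]. *)
Lemma design_wint_gt0 (R : realType) (n N k : nat) (C : 'I_N -> 'rV[R]_n)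
    (w : 'I_N -> R) (p : {poly R}) :
  (2 <= n)%N -> (1 <= N)%N -> design k C w -> (size p <= k.+1)%N -> p != 0 ->
  (forall t, -1 <= t <= 1 -> 0 <= p.[t]) -> 0 < wint n p.
Proof.
move=> n2 N1 des sp p0 pge; have [[_ CS w0 _] _] := des.
have [t t1 pt] := exists_nonroot p0.
pose i0 : 'I_N := Ordinal N1.
have [y y1 yt] := exists_dotp_eq n2 (CS i0) t1.
rewrite -(design_wintE n2 des sp y1) (bigD1 i0) //= ltr_wpDr //.
  apply: sumr_ge0 => i _; apply: mulr_ge0; first exact/ltW/w0.
  by apply: pge; exact: dotp_unit_bounds.
rewrite yt mulr_gt0 // lt_def pt pge //.
by case/andP: t1 => /ltW -> /ltW ->.
Qed.

(** * Repeated use of the theorem of Rolle and the Hermite remainder *)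

(** The new zeros interlace with the old ones, hence are disjoint from them.
    Sortedness of the new list from [x] on is part of the statement to make
    the induction go through. *)
Lemma rolle_zeros_path (R : realType) (g : R -> R) (a b x : R) (s : seq R) :
  path <%R x s ->
  {in x :: s, forall y, a <= y <= b /\ g y = 0} ->
  (forall t, a < t < b -> derivable g t 1) ->
  {in x :: s &, forall y z, y < z -> {within `[y, z], continuous g}} ->
  exists s', [/\ path <%R x s', size s' = size s,
    {in s', forall y, a < y < b /\ derive1 g y = 0} &
    {in s', forall y, y \notin x :: s}].
Proof.
move=> + + dg; elim: s x => [|y s IH] x /=; first by exists [::].
move=> /andP[xy pys] zg cg.
have sub : {subset y :: s <= x :: y :: s}.
  by move=> z zs; rewrite in_cons zs orbT.
have [||s' [ps' ss' zs' ds']] := IH y pys.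
- by move=> z /sub; exact: zg.
- by move=> z t /sub zi /sub ti; exact: cg.
have [/andP[ax xb] gx0] := zg x (mem_head _ _).
have [/andP[ay yb] gy0] := zg y (sub _ (mem_head _ _)).
have [|||c cxy dc] := @Rolle R g x y xy.
- move=> t; rewrite in_itv /= => /andP[xt ty]; apply: dg.
  by rewrite (le_lt_trans ax xt) (lt_le_trans ty yb).
- by apply: cg => //; [exact: mem_head | exact/sub/mem_head].
- by rewrite gx0 gy0.
move: cxy; rewrite in_itv /= => /andP[xc cy].
have gty z : z \in s' -> y < z.
  by move=> zs; have /allP/(_ z zs) := order_path_min lt_trans ps'.
have gts z : z \in s -> y < z.
  by move=> zs; have /allP/(_ z zs) := order_path_min lt_trans pys.
exists (c :: s'); split.
- rewrite /= xc /=; case: s' ps' {ss' zs' ds' gty} => //= z s' /andP[yz ->].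
  by rewrite (lt_trans cy yz).
- by rewrite /= ss'.
- move=> z; rewrite inE => /predU1P[->|/zs' //].
  rewrite (le_lt_trans ax xc) (lt_le_trans cy yb); split => //.
  by rewrite derive1E; have [_ ->] := dc.
move=> z; rewrite inE => /predU1P[->|zs].
  rewrite !inE !negb_or (gt_eqF xc) (lt_eqF cy) /=.
  by apply/negP => /gts; rewrite lt_gtF.
have := ds' z zs; rewrite [z \in x :: _]inE negb_or => ->.
by rewrite gt_eqF // (lt_trans xy (gty z zs)).
Qed.

(** Disjointness from [s] is what allows counting the zeros of [g'] at double
    zeros of [g] in addition to the ones found here. *)
Lemma rolle_zeros (R : realType) (g : R -> R) (a b : R) (s : seq R) :
  uniq s ->
  {in s, forall y, a <= y <= b /\ g y = 0} ->
  (forall t, a < t < b -> derivable g t 1) ->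
  {in s &, forall y z, y < z -> {within `[y, z], continuous g}} ->
  exists s', [/\ uniq s', size s' = (size s).-1,
    {in s', forall y, a < y < b /\ derive1 g y = 0} &
    {in s', forall y, y \notin s}].
Proof.
move=> us zg dg cg; set r := sort <=%O s.
have rs : r =i s by move=> y; rewrite mem_sort.
have lr : sorted <%R r by rewrite lt_sorted_uniq_le sort_uniq us sort_le_sorted.
have sr : size r = size s by rewrite size_sort.
case: r rs lr sr => [|x r] rs lr sr; first by exists [::]; rewrite -sr.
have [||s' [ps' ss' zs' ds']] := rolle_zeros_path lr _ dg.
- by move=> y; rewrite rs; exact: zg.
- by move=> y z; rewrite !rs; exact: cg.
exists s'; split => //.
- by have := path_sorted ps'; rewrite lt_sorted_uniq_le => /andP[].
- by rewrite ss' -sr.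
by move=> y /ds'; rewrite rs.
Qed.

Lemma iterated_rolle (R : realType) (g : R -> R) (a b : R) (n : nat)
    (s : seq R) :
  (forall j t, (j < n)%N -> a < t < b -> derivable (derive1n j g) t 1) ->
  uniq s -> size s = n.+1 ->
  {in s, forall y, a < y < b /\ g y = 0} ->
  exists2 xi, a < xi < b & derive1n n g xi = 0.
Proof.
elim: n g s => [|n IH] g s dg us ss zs.
  case: s us ss zs => // x s _ _ /(_ x (mem_head _ _))[xab gx].
  by exists x.
have d0 t : a < t < b -> derivable g t 1 by exact: (dg 0%N t).
have [||s' [us' ss' zs' _]] := rolle_zeros us _ d0.
- by move=> y /zs[/andP[/ltW -> /ltW ->] ->].
- move=> y z /zs[/andP[ay _] _] /zs[/andP[_ zb] _] yz.
  apply: derivable_within_continuous => t; rewrite in_itv /= => /andP[yt tz].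
  by apply: d0; rewrite (lt_le_trans ay yt) (le_lt_trans tz zb).
have [||xi xiab dxi] := IH (derive1 g) s' _ us' _ zs'.
- by move=> j t jn tab; rewrite -derive1Sn; exact: dg.
- by rewrite ss' ss.
by exists xi => //; rewrite derive1Sn.
Qed.

Lemma derive1n_sub_horner (R : realType) (F : R -> R) (q : {poly R}) (a b : R)
    (n : nat) :
  (forall j t, (j < n)%N -> a < t < b -> derivable (derive1n j F) t 1) ->
  forall j t, (j <= n)%N -> a < t < b ->
    derive1n j (F \- horner q) t = derive1n j F t - (derivn j q).[t] /\
    ((j < n)%N -> derivable (derive1n j (F \- horner q)) t 1).
Proof.
move=> dF; elim=> [|j IH] t jn tab.
  split; first by rewrite derivn0.
  move=> n0; apply: derivableB; first exact: (dF 0%N).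
  exact: derivable_horner.
have near_itv (P : R -> Prop) u : a < u < b ->
    (forall v, a < v < b -> P v) -> \forall v \near u, P v.
  move=> uab Pv; have : u \in `]a, b[ by rewrite in_itv.
  by move=> /near_in_itvoo; apply: filterS => v; rewrite in_itv /=; exact: Pv.
have E u : a < u < b -> derive1n j.+1 (F \- horner q) u =
    derive1n j.+1 F u - (derivn j.+1 q).[u].
  move=> uab; rewrite derive1nS derive1E derivnS.
  have /near_eq_derive -> : \forall v \near u, derive1n j (F \- horner q) v =
      (derive1n j F \- horner (derivn j q)) v.
    by apply: near_itv uab _ => v vab; have [] := IH v (ltnW jn) vab.
  rewrite deriveB; [|exact: dF|exact: derivable_horner].
  by rewrite -!derive1E derivE.
split; first exact: E.
move=> jn'; apply: (@near_eq_derivable _ _ _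
    (derive1n j.+1 F \- horner (derivn j.+1 q))).
  by apply: near_itv tab _ => v /E ->.
by apply: derivableB; [exact: dF | exact: derivable_horner].
Qed.

(** Simple zeros at [s0] and double zeros at [s]. *)
Definition node_poly (R : realType) (s0 s : seq R) : {poly R} :=
  (\prod_(y <- s0) ('X - y%:P)) * (\prod_(y <- s) ('X - y%:P)) ^+ 2.

Lemma node_poly_monic (R : realType) (s0 s : seq R) :
  node_poly s0 s \is monic.
Proof. by rewrite /node_poly rpredM ?rpredX ?monic_prod_XsubC. Qed.

Lemma size_node_poly (R : realType) (s0 s : seq R) :
  size (node_poly s0 s) = (size s0 + 2 * size s).+1.
Proof.
rewrite /node_poly size_monicM ?monic_prod_XsubC //; last first.
  by rewrite monic_neq0 ?rpredX ?monic_prod_XsubC.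
rewrite expr2 size_monicM ?monic_prod_XsubC ?monic_neq0 ?monic_prod_XsubC //.
by rewrite !size_prod_XsubC; lia.
Qed.

Lemma horner_prod_sub (R : realType) (s : seq R) (t : R) :
  (\prod_(y <- s) ('X - y%:P)).[t] = \prod_(y <- s) (t - y).
Proof. by rewrite horner_prod; apply: eq_bigr => y _; rewrite hornerXsubC. Qed.

Lemma node_polyE (R : realType) (s0 s : seq R) (t : R) :
  (node_poly s0 s).[t] =
  (\prod_(y <- s0) (t - y)) * (\prod_(y <- s) (t - y)) ^+ 2.
Proof. by rewrite hornerM horner_exp !horner_prod_sub. Qed.

Lemma node_poly_eq0 (R : realType) (s0 s : seq R) (t : R) :
  ((node_poly s0 s).[t] == 0) = (t \in s0 ++ s).
Proof.
rewrite hornerM horner_exp mulf_eq0 sqrf_eq0 mem_cat.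
by rewrite -!rootE !root_prod_XsubC.
Qed.

Lemma deriv_node_poly (R : realType) (s0 s : seq R) (t : R) :
  t \in s -> (node_poly s0 s)^`().[t] = 0.
Proof.
rewrite -root_prod_XsubC => /eqP h.
by rewrite /node_poly derivM deriv_exp /= !hornerE /= h; ring.
Qed.

Lemma derivn_monic (R : realType) (p : {poly R}) (d : nat) :
  p \is monic -> size p = d.+1 -> derivn d p = d`!%:R%:P.
Proof.
move=> /monicP lp sp.
have -> : p = (p - 'X^d) + 'X^d by rewrite subrK.
rewrite derivnD derivnXn ffactnn subnn expr0 derivn_poly0 ?add0r //.
  by rewrite polyC_natr.
apply/leq_sizeP => j; rewrite leq_eqVlt => /predU1P[<-|dj].
  by rewrite coefB coefXn eqxx -lp lead_coefE sp subrr.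
by rewrite coefB coefXn gtn_eqF // nth_default ?subr0 // sp.
Qed.

(** The error of interpolation with simple nodes [s0] and double nodes [s].
    Subtract from [F - p] the multiple [K] of the node polynomial that makes
    the difference [g] vanish at [t] too.  Then [g] has [|s0| + |s| + 1] zeros,
    so [g'] has [|s0| + |s|] further zeros between them and [|s|] zeros at the
    double nodes: [d] in all, and [g^(d)] vanishes somewhere.

    Continuity is asked only between points of the list, so that [F] may be
    discontinuous at an endpoint that is not on it. *)
Lemma hermite_remainder (R : realType) (F : R -> R) (p : {poly R})
    (a b t : R) (s0 s : seq R) :
  let d := (size s0 + 2 * size s)%N in
  (0 < d)%N -> uniq (t :: s0 ++ s) -> (size p <= d)%N ->
  {in t :: s0 ++ s, forall y, a <= y <= b} ->
  {in s, forall y, a < y < b} ->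
  {in s0 ++ s, forall y, F y = p.[y]} ->
  {in s, forall y, derive1 F y = p^`().[y]} ->
  (forall j u, (j < d)%N -> a < u < b -> derivable (derive1n j F) u 1) ->
  {in t :: s0 ++ s &, forall y z, y < z -> {within `[y, z], continuous F}} ->
  exists2 xi, a < xi < b &
    F t - p.[t] = derive1n d F xi / d`!%:R * (node_poly s0 s).[t].
Proof.
move=> d d0 us sp ab sab Fp dFp dF cF.
have wt : (node_poly s0 s).[t] != 0.
  by rewrite node_poly_eq0; case/andP: us.
set om := node_poly s0 s in wt *.
(* The multiple of the node polynomial that adds [t] to the zeros. *)
pose K := (F t - p.[t]) / om.[t]; pose q := p + K *: om.
have dg := derive1n_sub_horner q dF; set g := F \- horner q in dg.
have g0 : {in t :: s0 ++ s, forall y, g y = 0}.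
  move=> y; rewrite /g /q /= inE => /predU1P[->|ys].
    by rewrite hornerD hornerZ divfK //; ring.
  rewrite hornerD hornerZ (Fp y ys) (eqP (_ : om.[y] == 0)) ?node_poly_eq0 //.
  by rewrite mulr0 addr0 subrr.
have [|||s1 [us1 ss1 zs1 ds1]] := rolle_zeros us (a := a) (b := b) (g := g).
- by move=> y ys; split; [exact: ab | exact: g0].
- by move=> u uab; have [_] := dg 0%N u (leq0n _) uab; apply.
- move=> y z yi zi yz; apply: within_continuousB; first exact: cF.
  by apply: continuous_subspaceT; exact: continuous_horner.
have [||||xi xiab dxi] := @iterated_rolle R (derive1 g) a b d.-1 (s1 ++ s).
- move=> j u jd uab; rewrite -derive1Sn.
  have jd' : (j.+1 < d)%N by lia.
  by have [_] := dg j.+1 u (ltnW jd') uab; apply.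
- have : uniq s by move: us; rewrite /= cat_uniq => /and4P[].
  rewrite cat_uniq us1 => ->; rewrite andbT /=.
  apply/hasPn => y ys; apply/negP => /ds1.
  by rewrite inE mem_cat ys !orbT.
- by rewrite size_cat ss1 /= size_cat; rewrite /d; lia.
- move=> y; rewrite mem_cat => /orP[/zs1 //|ys]; split; first exact: sab.
  have [E _] := dg 1%N y d0 (sab y ys); have := E.
  rewrite derive1n1 => ->; rewrite derive1n1 dFp // derivn1 /q derivD derivZ.
  by rewrite hornerD hornerZ deriv_node_poly // mulr0 addr0 subrr.
exists xi => //; move: dxi; rewrite -derive1Sn prednK //.
have [-> _] := dg d xi (leqnn d) xiab.
rewrite /q derivnD derivnZ derivn_poly0 // add0r.
rewrite (@derivn_monic _ om d) ?node_poly_monic ?size_node_poly //.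
rewrite hornerZ hornerC => /eqP; rewrite subr_eq0 => /eqP ->.
by rewrite mulfK ?pnatr_eq0 -?lt0n ?fact_gt0 // /K divfK.
Qed.

(** * Hermite interpolation of an admissible potential from below *)

Lemma node_poly_cons (R : realType) (x : R) (s0 s : seq R) :
  node_poly (x :: s0) s = ('X - x%:P) * node_poly s0 s.
Proof. by rewrite /node_poly big_cons mulrA. Qed.

(** Newton's scheme: adding a multiple of the current node polynomial adjusts
    the value at a new node, and a multiple of the next one adjusts the
    derivative there, without changing what has been achieved before. *)
Lemma hermite_interpolant (R : realType) (v v' : R -> R) (s0 s : seq R) :
  uniq (s0 ++ s) ->
  exists p : {poly R}, [/\ (size p <= size s0 + 2 * size s)%N,
    {in s0 ++ s, forall y, p.[y] = v y} &
    {in s, forall y, p^`().[y] = v' y}].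
Proof.
have size_add (p q : {poly R}) k : (size p <= k)%N -> (size q <= k)%N ->
    (size (p + q)%R <= k)%N.
  move=> pk qk; apply: leq_trans (size_polyD _ _) _.
  by rewrite geq_max pk qk.
have step (x : R) (r0 r : seq R) (p : {poly R}) : x \notin r0 ++ r ->
    (size p <= size r0 + 2 * size r)%N ->
    {in r0 ++ r, forall y, p.[y] = v y} ->
    {in r, forall y, p^`().[y] = v' y} ->
    exists p1 : {poly R}, [/\ (size p1 <= size r0 + 2 * size r + 1)%N,
      {in x :: r0 ++ r, forall y, p1.[y] = v y} &
      {in r, forall y, p1^`().[y] = v' y}].
  move=> xr sp pv pv'; set om := node_poly r0 r.
  have omx : om.[x] != 0 by rewrite node_poly_eq0.
  exists (p + ((v x - p.[x]) / om.[x]) *: om); split.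
  - apply: size_add; first by rewrite (leq_trans sp) // leq_addr.
    apply: leq_trans (size_scale_leq _ _) _.
    by rewrite size_node_poly addn1.
  - move=> y; rewrite inE hornerD hornerZ => /predU1P[->|yr].
      by rewrite divfK // addrC subrK.
    rewrite pv // (eqP (_ : om.[y] == 0)) ?node_poly_eq0 //.
    by rewrite mulr0 addr0.
  - move=> y yr; rewrite derivD derivZ hornerD hornerZ.
    by rewrite deriv_node_poly // mulr0 addr0 pv'.
elim: s => [|x s IH] us.
  rewrite cats0 in us *; elim: s0 us => [|x s0 IH] /=.
    by exists 0; split => //; rewrite size_poly0.
  move=> /andP[xs0 /IH[p [sp pv _]]].
  have [||||p1 [sp1 pv1 _]] := step x s0 [::] p; rewrite ?cats0 //.
  exists p1; split => //; first by move: sp1 => /=; lia.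
  by move: pv1; rewrite cats0.
have [xs us'] : x \notin s0 ++ s /\ uniq (s0 ++ s).
  move: us; rewrite (perm_uniq (permEl (perm_catCA s0 [:: x] s))) /=.
  by move=> /andP[].
have [p [sp pv pv']] := IH us'.
have [p1 [sp1 pv1 pv1']] := step x s0 s p xs sp pv pv'.
set om := node_poly (x :: s0) s.
have omx : (node_poly s0 s).[x] != 0 by rewrite node_poly_eq0.
have dom : om^`().[x] = (node_poly s0 s).[x].
  rewrite /om node_poly_cons derivM derivXsubC mul1r.
  by rewrite hornerD [X in _ + X]hornerM hornerXsubC subrr mul0r addr0.
have om0 y : y \in x :: s0 ++ s -> om.[y] = 0.
  by move=> ys; apply/eqP; rewrite node_poly_eq0.
exists (p1 + ((v' x - p1^`().[x]) / om^`().[x]) *: om); split.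
- apply: size_add; first by move: sp1 => /=; lia.
  apply: leq_trans (size_scale_leq _ _) _.
  by rewrite size_node_poly /=; lia.
- move=> y ys; rewrite hornerD hornerZ.
  have ys' : y \in x :: s0 ++ s.
    by move: ys; rewrite (perm_mem (permEl (perm_catCA s0 [:: x] s))).
  by rewrite om0 // mulr0 addr0 pv1.
- move=> y; rewrite derivD derivZ hornerD hornerZ inE => /predU1P[->|ys].
    by rewrite divfK ?dom // addrC subrK.
  by rewrite (deriv_node_poly _ ys) mulr0 addr0 pv1'.
Qed.

Section Admissible.
Variables (R : realType) (f : R -> \bar R).
Hypothesis hf : admissible f.

Lemma admissible_fine (t : R) : -1 <= t <= 1 -> f t != +oo%E ->
  f t = (fine (f t))%:E.
Proof.
case: hf => fN _ _ _ _ t1 ft; rewrite fineK // fin_numE ft andbT.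
exact: fN.
Qed.

Lemma admissible_fine_oo (t : R) : -1 < t < 1 -> f t = (fine (f t))%:E.
Proof. by case: hf => _ ff _ _ _ t1; rewrite fineK // ff. Qed.

Lemma admissible_within_continuous (y z : R) :
  -1 <= y <= 1 -> -1 <= z <= 1 -> y < z ->
  f y != +oo%E -> f z != +oo%E ->
  {within `[y, z], continuous (fine \o f)}.
Proof.
move=> /[dup] y1 /andP[y1l _] /[dup] z1 /andP[_ z1r] yz fy fz.
have [_ _ df fN1 f1] := hf.
have cont t : -1 < t < 1 -> {for t, continuous (fine \o f)}.
  by move=> /df /derivable1_diffP /differentiable_continuous.
apply/continuous_within_itvP => //; split.
- move=> t; rewrite in_itv /= => /andP[yt tz]; apply: cont.
  by rewrite (le_lt_trans y1l yt) (lt_le_trans tz z1r).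
- have [y0|yN1] := eqVneq y (-1).
    apply: fine_cvg; rewrite /= -admissible_fine // y0; exact: fN1.
  apply/cvg_at_right_filter/cont.
  by rewrite lt_def yN1 y1l (lt_le_trans yz z1r).
- have [z0|zN1] := eqVneq z 1.
    apply: fine_cvg; rewrite /= -admissible_fine // z0; exact: f1.
  apply/cvg_at_left_filter/cont.
  by rewrite (le_lt_trans y1l yz) lt_def eq_sym zN1 z1r.
Qed.

Lemma admissible_remainder (p : {poly R}) (t : R) (s0 s : seq R) :
  let d := (size s0 + 2 * size s)%N in
  (0 < d)%N -> uniq (t :: s0 ++ s) -> (size p <= d)%N ->
  {in t :: s0, forall y, -1 <= y <= 1 /\ f y != +oo%E} ->
  {in s, forall y, -1 < y < 1} ->
  {in s0 ++ s, forall y, p.[y] = (fine \o f) y} ->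
  {in s, forall y, p^`().[y] = derive1 (fine \o f) y} ->
  has_deriv_n d f ->
  exists2 xi, -1 < xi < 1 &
    fine (f t) - p.[t] =
      derive1n d (fine \o f) xi / d`!%:R * (node_poly s0 s).[t].
Proof.
move=> d d0 us sp s0b sb pF pF' df.
have all1 : {in t :: s0 ++ s, forall y, -1 <= y <= 1 /\ f y != +oo%E}.
  move=> y; rewrite -cat_cons mem_cat => /orP[/s0b //|/sb yb].
  split; first by case/andP: yb => /ltW -> /ltW ->.
  by rewrite admissible_fine_oo.
apply: hermite_remainder => //.
- by move=> y /all1[].
- by move=> y ys; rewrite pF.
- by move=> y ys; rewrite pF'.
move=> y z /all1[y1 fy] /all1[z1 fz] yz.
exact: admissible_within_continuous.
Qed.

(** Interpolate at [d] points of (0, 1).  Left of all of them the node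
    polynomial is negative, its degree [d] being odd, so [f] lies below its
    interpolant on (-1, 0) and is bounded near -1. *)
Lemma odd_deriv_ge0_finite (d : nat) : odd d -> deriv_n_ge0 d f ->
  f (-1) != +oo%E.
Proof.
move=> od [df df0]; have d0 : (0 < d)%N by case: (d) od.
have [s0 [us0 ss0 s0b]] := exists_uniq_seq_itv01 R d.
have [|p [sp pv _]] := @hermite_interpolant R (fine \o f) (fun=> 0) s0 [::].
  by rewrite cats0.
have fp t : -1 < t < 0 -> (f t <= p.[t]%:E)%E.
  move=> /andP[t1 t2]; have tI : -1 < t < 1 by rewrite t1 (lt_trans t2).
  rewrite (admissible_fine_oo tI) lee_fin -subr_le0.
  have := @admissible_remainder p t s0 [::].
  rewrite muln0 addn0 ss0 => -[] //.
  - rewrite cats0 /= us0 andbT; apply/negP => /s0b /andP[h _].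
    by have := lt_trans h t2; rewrite ltxx.
  - by move: sp; rewrite muln0 addn0 ss0.
  - move=> y; rewrite inE => /predU1P[->|/s0b /andP[y0 y1]].
      split; first by rewrite !ltW //; case/andP: tI.
      by rewrite (admissible_fine_oo tI).
    split; first by rewrite !ltW // (lt_trans _ y0) // ltrN10.
    by rewrite admissible_fine_oo // y1 andbT (lt_trans _ y0) // ltrN10.
  move=> xi xib ->; rewrite node_polyE big_nil expr1n mulr1.
  apply: mulr_ge0_le0; first by rewrite divr_ge0 ?df0.
  have -> : \prod_(y <- s0) (t - y) = - \prod_(y <- s0) (y - t).
    under eq_bigr => y _ do rewrite -opprB -mulN1r.
    rewrite big_split /= big_const_seq count_predT iter_mulr_1.
    by rewrite ss0 -signr_odd od expr1 mulN1r.
  rewrite oppr_le0 big_seq; apply: prodr_ge0 => y /s0b /andP[y0 _].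
  by rewrite subr_ge0 ltW // (lt_trans t2 y0).
have [_ _ _ fN1 _] := hf.
have : (f (-1) <= (\sum_(i < size p) `|p`_i|)%:E)%E.
  apply: (cvge_to_le fN1); near=> t.
  have tI : -1 < t < 0.
    apply/andP; split; first by near: t; exact: nbhs_right_gt.
    by near: t; apply: nbhs_right_lt; rewrite ltrN10.
  apply: le_trans (fp t tI) _; rewrite lee_fin.
  apply: le_trans (ler_norm _) _; apply: horner_norm_le.
  by case/andP: tI => /ltW -> t0; rewrite ltW // (lt_trans t0).
by move=> h; apply/eqP => e; move: h; rewrite e leye_eq.
Unshelve. all: by end_near. Qed.
End Admissible.

(** Double nodes contribute squares to the remainder and a simple node at -1
    contributes [t + 1 >= 0], so the remainder has the sign of the
    derivative. *)
Lemma hermite_minorant (R : realType) (f : R -> \bar R) (s0 s : seq R) :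
  let d := (size s0 + 2 * size s)%N in
  admissible f -> (0 < d)%N -> uniq (s0 ++ s) ->
  {in s0, forall y, y = -1 /\ f y != +oo%E} ->
  {in s, forall y, -1 < y < 1} ->
  deriv_n_ge0 d f ->
  exists p : {poly R}, [/\ (size p <= d)%N,
    {in s0 ++ s, forall y, f y = p.[y]%:E},
    forall t, -1 <= t <= 1 -> (p.[t]%:E <= f t)%E &
    deriv_n_gt0 d f -> forall t, -1 <= t <= 1 -> t \notin s0 ++ s ->
      (p.[t]%:E < f t)%E].
Proof.
move=> d hf d0 us s0b sb [df df0].
have s0b' y : y \in s0 -> -1 <= y <= 1 /\ f y != +oo%E.
  by move=> /s0b[-> ?]; split => //; rewrite lexx /=; lra.
have [p [sp pv pv']] :=
  hermite_interpolant (fine \o f) (derive1 (fine \o f)) us.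
have fp : {in s0 ++ s, forall y, f y = p.[y]%:E}.
  move=> y ys; rewrite pv //=.
  move: ys; rewrite mem_cat => /orP[/s0b'[? ?]|/sb].
    exact: admissible_fine.
  exact: admissible_fine_oo.
have om_gt0 t : -1 <= t <= 1 -> t \notin s0 ++ s -> 0 < (node_poly s0 s).[t].
  move=> /andP[t1 _] ts; rewrite lt_def node_poly_eq0 ts /= node_polyE.
  rewrite mulr_ge0 ?sqr_ge0 // big_seq; apply: prodr_ge0 => y /s0b[-> _].
  by rewrite subr_ge0.
have rem t : -1 <= t <= 1 -> t \notin s0 ++ s -> f t != +oo%E ->
    exists2 xi, -1 < xi < 1 & fine (f t) - p.[t] =
      derive1n d (fine \o f) xi / d`!%:R * (node_poly s0 s).[t].
  move=> t1 ts ft; apply: admissible_remainder => //.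
    by rewrite /= ts us.
  by move=> y; rewrite inE => /predU1P[->|/s0b'].
exists p; split => //.
- move=> t t1; have [/fp -> //|ts] := boolP (t \in s0 ++ s).
  have [->|ft] := eqVneq (f t) +oo%E; first exact: leey.
  rewrite (admissible_fine hf t1 ft) lee_fin -subr_ge0.
  have [xi xi1 ->] := rem t t1 ts ft.
  by rewrite mulr_ge0 ?divr_ge0 ?df0 // ltW // om_gt0.
move=> [_ df1] t t1 ts.
have [->|ft] := eqVneq (f t) +oo%E; first exact: ltry.
rewrite (admissible_fine hf t1 ft) lte_fin -subr_gt0.
have [xi xi1 ->] := rem t t1 ts ft.
by rewrite mulr_gt0 ?divr_gt0 ?df1 ?om_gt0 // ltr0n fact_gt0.
Qed.

(** * Nodes and weights of the quadrature *)

Lemma endpoint_factorE (R : realType) (nu : nat) :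
  endpoint_factor R 0 nu = ('X - (-1)%:P) ^+ nu.
Proof. by rewrite /endpoint_factor expr0 mul1r polyCN opprK addrC. Qed.

Lemma quadrature_single (R : realType) (nu m : nat) (lam tau : nat -> R)
    (p : {poly R}) (j : nat) :
  (1 - nu <= j <= m)%N ->
  (forall k, (1 - nu <= k <= m)%N -> k != j -> p.[lam k] = 0) ->
  \sum_(1 - nu <= k < m.+1) tau k * p.[lam k] = tau j * p.[lam j].
Proof.
move=> jm pz; rewrite (bigD1_seq j) ?iota_uniq //=; last first.
  by rewrite mem_index_iota.
rewrite big_seq_cond big1 ?addr0 // => k.
rewrite mem_index_iota => /andP[km kj].
by rewrite pz ?mulr0.
Qed.

Section Quadrature.
Variables (R : realType) (nu n m N : nat).
Variables (C : 'I_N -> 'rV[R]_n) (w : 'I_N -> R).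
Variables (lam tau : nat -> R).
Hypotheses (hnu : (nu <= 1)%N) (hn : (2 <= n)%N).
Hypotheses (hm : (1 <= m)%N) (hN : (1 <= N)%N).
Hypothesis hdes : design (2 * m - 1 + nu) C w.
Hypothesis hquad : quadrature n m 0 nu lam tau.

Lemma wint_quadrature (p : {poly R}) : (size p <= 2 * m + nu)%N ->
  wint n p = \sum_(1 - nu <= j < m.+1) tau j * p.[lam j].
Proof. by move=> sp; rewrite hquad.2 !addn0. Qed.

Lemma design_quadrature (p : {poly R}) (x : 'rV[R]_n) :
  (size p <= 2 * m + nu)%N -> unit_sphere x ->
  \sum_(i < N) w i * p.[dotp x (C i)] =
  \sum_(1 - nu <= j < m.+1) tau j * p.[lam j].
Proof.
move=> sp x1; rewrite (design_wintE hn hdes _ x1) ?wint_quadrature //.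
by apply: leq_trans sp _; lia.
Qed.

Lemma quadrature_wint_gt0 (p : {poly R}) : (size p <= 2 * m + nu)%N -> p != 0 ->
  (forall t, -1 <= t <= 1 -> 0 <= p.[t]) -> 0 < wint n p.
Proof. by move=> sp; apply: design_wint_gt0 hdes _ => //; lia. Qed.

(** If [r] were outside (-1, 1), then [P q (1+X)^nu] with [q = P / (X - r)]
    would be a nonzero polynomial of constant sign on [-1, 1], whereas its
    integral is 0 by orthogonality. *)
Lemma orthogonal_root_bounds (P : {poly R}) (r : R) :
  is_Pmunu n m 0 nu P -> root P r -> -1 < r < 1.
Proof.
move=> [sP orth _] /factor_theorem[q PE].
have P0 : P != 0 by rewrite -size_poly_eq0 sP.
have q0 : q != 0 by apply: contraNneq P0 => q0; rewrite PE q0 mul0r.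
have sq : size q = m.
  by move: sP; rewrite PE size_Mmonic ?monicXsubC // size_XsubC addn2 => -[].
have E0 : ('X - (-1)%:P) ^+ nu != 0 :> {poly R}.
  by rewrite expf_neq0 // polyXsubC_eq0.
pose G := q ^+ 2 * ('X - (-1)%:P) ^+ nu.
have G0 : G != 0 by rewrite mulf_neq0 // expf_neq0.
have Gge t : -1 <= t <= 1 -> 0 <= G.[t].
  move=> /andP[t1 _]; rewrite hornerM !horner_exp hornerXsubC.
  by rewrite mulr_ge0 ?sqr_ge0 // exprn_ge0 // subr_ge0.
have sG : (size G <= 2 * m + nu - 1)%N.
  apply: leq_trans (size_polyMleq _ _) _; rewrite size_exp_XsubC.
  have := size_polyMleq q q; rewrite -expr2 sq; lia.
have PG : P * q * endpoint_factor R 0 nu = ('X - r%:P) * G.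
  by rewrite endpoint_factorE PE /G; ring.
have orth0 : wint n (('X - r%:P) * G) = 0 by rewrite -PG orth // sq.
have sXG (a : {poly R}) : (size a <= 2)%N -> (size (a * G)%R <= 2 * m + nu)%N.
  move=> sa; apply: leq_trans (size_polyMleq _ _) _; move: sa sG hm.
  by move: (size a) (size G) => x y *; lia.
rewrite !ltNge -negb_or; apply/negP => /orP[rN1|r1].
  suff : 0 < wint n (('X - r%:P) * G) by rewrite orth0 ltxx.
  apply: quadrature_wint_gt0.
  - by apply: sXG; rewrite size_XsubC.
  - by rewrite mulf_neq0 // polyXsubC_eq0.
  move=> t /[dup] t1 /andP[t1l _]; rewrite hornerM hornerXsubC.
  by rewrite mulr_ge0 ?Gge // subr_ge0 (le_trans rN1).
suff : 0 < wint n ((-1) *: (('X - r%:P) * G)).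
  by rewrite wintZ // orth0 mulr0 ltxx.
apply: quadrature_wint_gt0.
- by apply: leq_trans (size_scale_leq _ _) _; apply: sXG; rewrite size_XsubC.
- by rewrite scaler_eq0 oppr_eq0 oner_eq0 /= mulf_neq0 // polyXsubC_eq0.
move=> t /[dup] t1 /andP[_ t1r]; rewrite hornerZ hornerM hornerXsubC mulrA.
by rewrite mulr_ge0 ?Gge // mulN1r opprB subr_ge0 (le_trans t1r).
Qed.

(** When [nu = 1], -1 is one of the nodes; it is the smallest since all others
    are roots of [P] and so larger. *)
Lemma nodes_location :
  (forall j, (1 <= j <= m)%N -> -1 < lam j < 1) /\ (nu = 1%N -> lam 0%N = -1).
Proof.
have [[P hP [inc rootE]] _] := hquad.
have rP j : (1 - nu <= j <= m)%N -> -1 < lam j < 1 \/ (nu = 1%N /\ lam j = -1).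
  move=> jm; have : root (P * endpoint_factor R 0 nu) (lam j).
    by apply/rootE; exists j; rewrite ?addn0.
  rewrite rootM endpoint_factorE => /orP[/(orthogonal_root_bounds hP)|].
    by left.
  case: (nu) hnu => [|[|]] // _; first by rewrite expr0 /root hornerE oner_eq0.
  by rewrite expr1 root_XsubC => /eqP ->; right.
have inner j : (1 <= j <= m)%N -> -1 < lam j < 1.
  move=> /andP[j1 jm]; case: (rP j) => //; first by lia.
  move=> [nu1 lj]; have l0 : lam 0%N < lam j by apply: inc => //; lia.
  case: (rP 0%N) => [|/andP[h _]|[_ h]]; first by lia.
  - by have := lt_trans h l0; rewrite lj ltxx.
  - by move: l0; rewrite h lj ltxx.
split => // nu1.
have : root (P * endpoint_factor R 0 nu) (-1).
  by rewrite rootM endpoint_factorE nu1 expr1 root_XsubC eqxx orbT.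
move=> /rootE[[//|k]] /andP[_ km] kE.
by have := inner k.+1; rewrite -kE ltxx addn0 in km * => /(_ km).
Qed.

Lemma lam_inj j k : (1 - nu <= j <= m)%N -> (1 - nu <= k <= m)%N ->
  lam j = lam k -> j = k.
Proof.
have [[P _ [inc _]] _] := hquad.
move=> /andP[j1 jm] /andP[k1 km] jk; case: (ltngtP j k) => // h.
- by have := inc j k j1 h; rewrite addn0 km jk ltxx => /(_ isT).
- by have := inc k j k1 h; rewrite addn0 jm jk ltxx => /(_ isT).
Qed.

Definition end_nodes : seq R := nseq nu (-1).
Definition inner_nodes : seq R := [seq lam j | j <- iota 1 m].

Lemma mem_nodes (t : R) :
  reflect (exists2 j, (1 - nu <= j <= m)%N & t = lam j)
    (t \in end_nodes ++ inner_nodes).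
Proof.
have [_ lam0] := nodes_location.
apply: (iffP idP); rewrite mem_cat.
  move=> /orP[|/mapP[j]].
    rewrite mem_nseq => /andP[nu0 /eqP ->]; exists 0%N; first by lia.
    by rewrite lam0 //; lia.
  by rewrite mem_iota => jm ->; exists j => //; lia.
move=> [[|j] jm ->].
  have nu1 : nu = 1%N by lia.
  by rewrite lam0 // mem_nseq nu1 eqxx.
by rewrite map_f ?orbT // mem_iota; lia.
Qed.

Lemma uniq_nodes : uniq (end_nodes ++ inner_nodes).
Proof.
have [inner _] := nodes_location.
rewrite cat_uniq; apply/and3P; split.
- by rewrite /end_nodes; case: (nu) hnu => [|[|]].
- apply/hasPn => t /mapP[j]; rewrite mem_iota => jm ->.
  rewrite mem_nseq; apply/nandP; right; rewrite gt_eqF //.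
  by have /andP[] := inner j ltac:(lia).
- rewrite map_inj_in_uniq ?iota_uniq // => j k; rewrite !mem_iota => jm km.
  by apply: lam_inj; lia.
Qed.

Lemma size_nodes : size (end_nodes ++ inner_nodes) = (m + nu)%N.
Proof. by rewrite size_cat size_nseq size_map size_iota addnC. Qed.

(** Apply the quadrature to the nonnegative polynomial that vanishes exactly at
    the other nodes: doubly at the inner ones, and simply at -1, which keeps
    the degree within the range of exactness. *)
Lemma tau_gt0 j : (1 - nu <= j <= m)%N -> 0 < tau j.
Proof.
move=> jm; have [inner lam0] := nodes_location.
pose p := if j == 0%N then node_poly [::] inner_nodes
  else node_poly end_nodes [seq lam k | k <- rem j (iota 1 m)].
have sp : (size p <= 2 * m + nu)%N.
  rewrite /p; case: (j =P 0%N) => j0; rewrite size_node_poly ?size_map.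
    by rewrite size_iota /=; lia.
  by rewrite size_rem ?mem_iota ?size_iota ?size_nseq; lia.
have p0 : p != 0.
  by rewrite /p; case: ifP => _; rewrite monic_neq0 ?node_poly_monic.
have pge t : -1 <= t <= 1 -> 0 <= p.[t].
  move=> /andP[t1 _]; rewrite /p; case: ifP => _; rewrite node_polyE.
    by rewrite big_nil mul1r sqr_ge0.
  rewrite mulr_ge0 ?sqr_ge0 // big_seq; apply: prodr_ge0 => y.
  by rewrite mem_nseq => /andP[_ /eqP ->]; rewrite subr_ge0.
have pz k : (1 - nu <= k <= m)%N -> k != j -> p.[lam k] = 0.
  move=> km kj; apply/eqP; rewrite /p.
  case: (j =P 0%N) => j0; rewrite node_poly_eq0.
    by rewrite map_f // mem_iota; lia.
  rewrite mem_cat; case: k km kj => [|k] km kj.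
    by rewrite lam0 ?mem_nseq; [rewrite eqxx andbT; lia | lia].
  rewrite map_f ?orbT // mem_rem_uniq ?iota_uniq // inE /= kj mem_iota; lia.
have := quadrature_wint_gt0 sp p0 pge.
rewrite wint_quadrature // (quadrature_single _ jm pz) pmulr_lgt0 //.
rewrite lt_def; apply/andP; split; last first.
  apply: pge; case: (posnP j) => [j0|j0].
    by rewrite j0 lam0; [lra | lia].
  by have /andP[/ltW -> /ltW ->] := inner j ltac:(lia).
apply/negP; rewrite /p; case: (j =P 0%N) => j0; rewrite node_poly_eq0.
  move=> /mapP[k]; rewrite mem_iota j0 => km /lam_inj; lia.
rewrite mem_cat mem_nseq => /orP[/andP[nu0 /eqP lj]|].
  by have /andP[] := inner j ltac:(lia); rewrite lj ltxx.
move=> /mapP[k]; rewrite mem_rem_uniq ?iota_uniq // inE /= mem_iota.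
move=> /andP[/eqP kj km].
by move=> /lam_inj; lia.
Qed.
Variable x : 'rV[R]_n.
Hypothesis x1 : unit_sphere x.

Lemma mem_dots (t : R) : reflect (exists i, t = dotp x (C i)) (t \in dots x C).
Proof.
rewrite /dots mem_undup; apply: (iffP mapP) => [[i _ ->]|[i ->]].
  by exists i.
by exists i; rewrite ?mem_enum.
Qed.

(** Compare the design sum and the quadrature on the polynomial that vanishes
    at all nodes except [lam j]. *)
Lemma node_weights :
  {subset dots x C <= end_nodes ++ inner_nodes} ->
  forall j, (1 - nu <= j <= m)%N ->
    \sum_(i < N | dotp x (C i) == lam j) w i = tau j.
Proof.
move=> sub j jm; pose r := rem (lam j) (end_nodes ++ inner_nodes).
have un := uniq_nodes.
have mn t : reflect _ _ := mem_nodes t.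
have jn : lam j \in end_nodes ++ inner_nodes by apply/mn; exists j.
pose p : {poly R} := \prod_(y <- r) ('X - y%:P).
have pr t : (p.[t] == 0) = (t \in r) by rewrite -root_prod_XsubC.
have pj : p.[lam j] != 0 by rewrite pr mem_rem_uniqF.
have pz t : t \in end_nodes ++ inner_nodes -> t != lam j -> p.[t] = 0.
  by move=> ts tj; apply/eqP; rewrite pr mem_rem_uniq // inE /= tj.
have sp : (size p <= 2 * m + nu)%N.
  by rewrite size_prod_XsubC size_rem // size_nodes; lia.
apply: (mulIf pj).
rewrite -(quadrature_single _ jm); last first.
  move=> k km kj; apply: pz; first by apply/mn; exists k.
  by apply: contraNneq kj => /(lam_inj km jm) ->.
rewrite -(design_quadrature sp x1) mulr_suml.
rewrite big_mkcond; apply: eq_bigr => i _; case: eqP => [->//|/eqP ij].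
by rewrite pz ?mulr0 //; apply: sub; apply/mem_dots; exists i.
Qed.

(** Let [q] vanish at the dot products and [p] at the inner nodes other than
    [lam j].  The design sum of [q p] is 0, while its quadrature is
    [tau_j q(lam_j) p(lam_j)]; hence every node is a dot product, and the two
    sets have the same size. *)
Lemma dots_eq_nodes : size (dots x C) = (m + nu)%N ->
  (nu = 1%N -> -1 \in dots x C) ->
  dots x C =i end_nodes ++ inner_nodes.
Proof.
move=> sd dN1.
have un := uniq_nodes.
have mn t : reflect _ _ := mem_nodes t.
have [inner lam0] := nodes_location.
pose q : {poly R} := \prod_(t <- dots x C) ('X - t%:P).
have qr t : (q.[t] == 0) = (t \in dots x C) by rewrite -root_prod_XsubC.
suff sub : {subset end_nodes ++ inner_nodes <= dots x C}.
  have [] // := uniq_min_size un sub.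
    by rewrite size_nodes sd.
  by move=> _ e t; rewrite e.
move=> t /mn[j jm ->]; case: (posnP j) => [j0|j0].
  by rewrite j0 lam0; [apply: dN1; lia | lia].
pose r := [seq lam k | k <- rem j (iota 1 m)].
pose p : {poly R} := \prod_(y <- r) ('X - y%:P).
have sqp : (size (q * p)%R <= 2 * m + nu)%N.
  apply: leq_trans (size_polyMleq _ _) _.
  by rewrite !size_prod_XsubC sd size_map size_rem ?size_iota ?mem_iota; lia.
have := design_quadrature sqp x1.
rewrite big1; last first.
  move=> i _; rewrite hornerM (eqP (_ : q.[_] == 0)) ?mul0r ?mulr0 //.
  by rewrite qr; apply/mem_dots; exists i.
rewrite (quadrature_single _ jm); last first.
  move=> k km kj; apply/eqP; rewrite hornerM mulf_eq0 qr; apply/orP.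
  case: (posnP k) => [k0|k0].
    by left; rewrite k0 lam0; [apply: dN1; lia | lia].
  right; rewrite -rootE root_prod_XsubC map_f //.
  by rewrite mem_rem_uniq ?iota_uniq // inE /= kj mem_iota; lia.
have tj := tau_gt0 jm.
move=> /esym/eqP; rewrite mulf_eq0 gt_eqF //= hornerM mulf_eq0 qr => /orP[//|].
rewrite -rootE root_prod_XsubC => /mapP[k].
rewrite mem_rem_uniq ?iota_uniq // inE /= mem_iota => /andP[/eqP kj km].
by move=> /(lam_inj) e; case: kj; rewrite -e //; lia.
Qed.
End Quadrature.

(** * The universal bound *)

Theorem theorem5p2 (R : realType) (nu n m N : nat) (f : R -> \bar R)
    (C : 'I_N -> 'rV[R]_n) (w : 'I_N -> R) (lam tau : nat -> R)
    (hnu : (nu <= 1)%N) (hn : (2 <= n)%N) (hm : (1 <= m)%N) (hN : (1 <= N)%N)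
    (hf : admissible f) (hfd : deriv_n_ge0 (2 * m + nu) f)
    (hCw : weighted_code C w) (hdes : design (2 * m - 1 + nu) C w)
    (hquad : quadrature n m 0 nu lam tau) :
  let bound := (\sum_(1 - nu <= j < m.+1) (tau j)%:E * f (lam j))%E in
  [/\ (forall x, unit_sphere x -> (bound <= potential f C w x)%E),
      ((nu = 0%N /\ stiff m C w) \/ (nu = 1%N /\ weakly_sharp m C w) ->
        forall x, setA0 nu C x -> size (dots x C) = (m + nu)%N ->
          potential f C w x = bound)
    & (deriv_n_gt0 (2 * m + nu) f ->
        forall x, unit_sphere x -> potential f C w x = bound ->
        [/\ setA0 nu C x /\
              (size (dots x C) = (m + nu)%N /\
               forall t : R, t \in dots x C <->
                 exists2 j : nat, (1 - nu <= j <= m)%N & t = lam j),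
            (nu = 0%N -> stiff m C w) /\ (nu = 1%N -> weakly_sharp m C w)
          & forall j : nat, (1 - nu <= j <= m)%N ->
              \sum_(i < N | dotp x (C i) == lam j) w i = tau j])].
Proof.
pose s0 := end_nodes R nu; pose s := inner_nodes m lam.
have [_ CS w0 _] := hCw.
have Cinj : injective C by case: hCw.
have [inner lam0] := nodes_location hnu hn hm hN hdes hquad.
have un : uniq (s0 ++ s) := uniq_nodes hnu hn hm hN hdes hquad.
have nodeP t : reflect _ (t \in s0 ++ s) :=
  mem_nodes hnu hn hm hN hdes hquad t.
have dE : (size s0 + 2 * size s = 2 * m + nu)%N.
  by rewrite size_nseq size_map size_iota addnC.
have fN1 y : y \in s0 -> y = -1 /\ f y != +oo%E.
  rewrite mem_nseq => /andP[nu0 /eqP ->]; split => //.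
  apply: odd_deriv_ge0_finite hfd => //.
  by have -> : nu = 1%N by [lia]; rewrite addn1 /= mul2n odd_double.
have sI y : y \in s -> -1 < y < 1.
  by move=> /mapP[j]; rewrite mem_iota => jm ->; apply: inner; lia.
have := hermite_minorant hf _ un fN1 sI; rewrite dE.
have d0 : (0 < 2 * m + nu)%N by lia.
move=> /(_ d0 hfd)[p [sp fp pf pf1]].
have boundE x : unit_sphere x ->
    (\sum_(1 - nu <= j < m.+1) (tau j)%:E * f (lam j))%E
    = (\sum_(i < N) w i * p.[dotp x (C i)])%:E.
  move=> x1; rewrite (design_quadrature hnu hn hm hN hdes hquad sp x1) -sumEFin.
  apply: eq_big_nat => j jm; rewrite fp //.
  by apply/nodeP; exists j.
have dom x i : unit_sphere x -> ((w i * p.[dotp x (C i)])%:E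
    <= (w i)%:E * f (dotp x (C i)))%E.
  move=> x1; rewrite EFinM; apply: lee_wpmul2l; first by rewrite lee_fin ltW.
  by apply: pf; exact: dotp_unit_bounds.
have eq_pot x : unit_sphere x -> {subset dots x C <= s0 ++ s} ->
    potential f C w x = (\sum_(1 - nu <= j < m.+1) (tau j)%:E * f (lam j))%E.
  move=> x1 sub; rewrite (boundE x x1) -sumEFin; apply: eq_bigr => i _.
  by rewrite EFinM fp //; apply: sub; apply/mem_dots; exists i.
move=> bound; split.
- move=> x x1; rewrite /bound (boundE x x1) -sumEFin.
  by apply: lee_sum => i _; exact: dom.
- move=> _ x xA sd.
  have [x1 dN1] : unit_sphere x /\ (nu = 1%N -> -1 \in dots x C).
    move: xA; rewrite /setA0; case: eqP => [-> //|nu0 [i _ <-]].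
    split; first by rewrite /unit_sphere /= dotpNl dotpNr opprK; exact: CS.
    move=> _; apply/mem_dots; exists i.
    by rewrite dotpNl (CS i : dotp _ _ = 1).
  apply: eq_pot => // t.
  by rewrite (dots_eq_nodes hnu hn hm hN hdes hquad x1 sd dN1).
move=> hgt x x1 eqb.
have sub : {subset dots x C <= s0 ++ s}.
  move=> t /mem_dots[i ->]; apply: contraT => ns.
  have : (bound < potential f C w x)%E; last by rewrite eqb ltxx.
  rewrite /bound (boundE x x1) /potential (bigD1 i) //= EFinD.
  rewrite [X in (_ < X)%E](bigD1 i) //=.
  apply: lte_leD => //.
    rewrite EFinM lte_pmul2l ?lte_fin //.
    by apply: (pf1 hgt) => //; exact: dotp_unit_bounds.
  by rewrite -sumEFin; apply: lee_sum => k _; exact: dom.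
(* The weights at a node add up to [tau j], so a node that is not a dot product
   would have [tau j = 0]. *)
have nw := node_weights hnu hn hm hN hdes hquad x1 sub.
have dn : dots x C =i s0 ++ s.
  move=> t; apply/idP/idP => [/sub //|/nodeP[j jm ->]].
  apply: contraT => nd; have := tau_gt0 hnu hn hm hN hdes hquad jm.
  rewrite -nw // big1 ?ltxx // => i /eqP e.
  by case/negP: nd; apply/mem_dots; exists i.
have sd : size (dots x C) = (m + nu)%N.
  rewrite -(size_nodes nu m lam); apply: perm_size; apply: uniq_perm => //.
  exact: undup_uniq.
have xC : nu = 1%N -> exists k, x = - C k.
  move=> nu1; have /mem_dots[k kE] : -1 \in dots x C.
    by rewrite dn mem_cat mem_nseq nu1 eqxx.
  by exists k; apply: dotp_unit_eqN1.
split => //.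
- split; last first.
    split => // t; rewrite dn; split=> [/nodeP //|h]; exact/nodeP.
  rewrite /setA0; case: eqP => // nu0.
  have [k ->] : exists k, x = - C k by apply: xC; lia.
  by exists k.
split=> [nu0|nu1].
  split => //; first by move: hdes; rewrite nu0 addn0.
  by exists x => //; rewrite sd nu0 addn0.
have [k xk] := xC nu1; split => //.
  by move: hdes; rewrite nu1 (_ : 2 * m - 1 + 1 = 2 * m)%N //; lia.
(* As [x = - C k], the dot products of [C k] are the opposites of those of [x],
   and -1 is attained only at the point [C k] itself. *)
exists k; have <- : size [seq - y | y <- s] = m by rewrite !size_map size_iota.
apply: uniq_leq_size; first exact: undup_uniq.
move=> t; rewrite mem_undup => /mapP[i]; rewrite mem_filter => /andP[ik _] ->.
have : dotp x (C i) \in s0 ++ s by rewrite -dn; apply/mem_dots; exists i.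
rewrite mem_cat mem_nseq => /orP[/andP[_ /eqP e]|ds].
  have := dotp_unit_eqN1 x1 (CS i) e; rewrite xk => /oppr_inj /Cinj ki.
  by rewrite ki eqxx in ik.
by apply/mapP; exists (dotp x (C i)) => //; rewrite xk dotpNl opprK.
Qed.
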